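(* Let $A\in\mathbb{R}^{n\times n}$, $T>0$, $X_0=c_x+G_x\mathbf{B}_{p_x}\in\mathbb{A}_n$ and $U=c_u+G_u\mathbf{B}_{p_u}\in\mathbb{A}_n$. Let $N\in\mathbb{N}$, $\epsilon_h,\epsilon_u\in[0,1)$, $\tau=T/N$, and assume $\tau\in\mathbb{I}$. Define $\mathcal{S}_0^N=X_0$, $\mathcal{S}_i^N=\mathcal{H}(\tau,\mathcal{S}_{i-1}^N,\epsilon_h)$ for $i\in\{1,\dots,N\}$; $\mathcal{V}_0^N=\mathcal{I}(\tau,U,\epsilon_u)$, $\mathcal{V}_i^N=\mathcal{H}(\tau,\mathcal{V}_{i-1}^N,\epsilon_h)$ for $i\in\{1,\dots,N\}$; $\mathcal{W}_0^N=\{0\}$, $\mathcal{W}_i^N=\mathcal{W}_{i-1}^N+\mathcal{V}_{i-1}^N$ for $i\in\{1,\dots,N\}$; $\Lambda_i^N=\mathcal{S}_i^N+\mathcal{W}_i^N$ for $i\in\{0,\dots,N\}$. Define also $S_0^N=X_0$, $S_i^N=\mathrm{e}^{\tau A}S_{i-1}^N$; $V_0^N=\mathcal{R}_u(\tau)$, $V_i^N=\mathrm{e}^{\tau A}V_{i-1}^N$; $W_0^N=\{0\}$, $W_i^N=W_{i-1}^N+V_{i-1}^N$; $\Gamma_i^N=S_i^N+W_i^N$. Then for all $i\in\{0,\dots,N\}$: $\mathcal{S}_i^N\subseteq S_i^N=\mathcal{R}_h(i\tau)$, $\mathcal{V}_i^N\subseteq V_i^N$, $\mathcal{W}_i^N\subseteq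 W_i^N=\mathcal{R}_u(i\tau)$ and $\Lambda_i^N\subseteq\Gamma_i^N=\mathcal{R}(i\tau)$. Furthermore $\bigcup_{i=0}^N\Lambda_i^N\subseteq\mathcal{R}([0,T])$.
   Context: A norm $\|\cdot\|$ is fixed on each $\mathbb{R}^k$, $\mathbf{B}_k$ is its closed unit ball, matrices carry induced norms, $G^\dagger$ is the Moore–Penrose inverse, $\rho(A)$ the spectral radius. $\mathbb{A}_n$ is the collection of sets $\Omega=c+G\mathbf{B}_p$ with $c\in\mathbb{R}^n$, $G\in\mathbb{R}^{n\times p}$, $\mathrm{rank}(G)=n$; such a set is always regarded together with its representation $(c,G)$. Minkowski sums and linear images are used; set-valued integral $\int_0^tF(s)W\,\mathrm{d}s=\bigcup_w\int_0^tF(s)w(s)\,\mathrm{d}s$ over measurable $w:[0,t]\to W$. Reachable sets: $\mathcal{R}_h(t)=\mathrm{e}^{tA}X_0$, $\mathcal{R}_u(t)=\int_0^t\mathrm{e}^{sA}U\,\mathrm{d}s$, $\mathcal{R}(t)=\mathcal{R}_h(t)+\mathcal{R}_u(t)$, $\mathcal{R}([0,T])=\bigcup_{t\in[0,T]}\mathcal{R}(t)$. $\mathbb{I}=\{t\ge0:\int_0^t\mathrm{e}^{sA}\mathrm{d}s\text{ invertible}\}$. $\mathcal{L}(t,k)=\sum_{j=0}^{k-1}(tA)^j/j!$, $\mathcal{T}(t,k)=\sum_{j=0}^{k-1}t^{j+1}A^j/(j+1)!$, $\theta(r,k)=\sum_{j=k}^\infty r^j/j!$. For $\Omega=c+G\mathbf{B}_p\in\mathbb{A}_n$: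 $\lambda(t,\Omega,k)=\dfrac{1-\mathrm{e}^{t\|A\|}\theta(t\|A\|,k)\|G^\dagger\|\|c\|}{1+\mathrm{e}^{t\|A\|}\theta(t\|A\|,k)\|G^\dagger\|\|G\|}$. $k_{\min}(t)=\min\{k\in\mathbb{N}:\theta(t\rho(A),k)\mathrm{e}^{t\rho(A)}<1\}$. $\kappa(t,\Omega,\epsilon)=\min\{k\in\mathbb{N}:\ k\ge\max(k_{\min}(t),2),\ \lambda(t,\Omega,k)>\epsilon\}$ for $t\ge0$, $\epsilon\in[0,1)$. $\eta(t,\Omega,\epsilon)=\min\{k\in\mathbb{N}:\lambda(t,\Omega,k)>\epsilon,\ \mathcal{T}(t,k)\text{ invertible}\}$ for $t\in\mathbb{I}$, $\epsilon\in[0,1)$. $\mathcal{H}(t,\Omega,\epsilon)=\mathcal{L}(t,\kappa)[c+\lambda(t,\Omega,\kappa)G\mathbf{B}_p]$ with $\kappa=\kappa(t,\Omega,\epsilon)$, represented with center $\mathcal{L}(t,\kappa)c$ and generator matrix $\lambda(t,\Omega,\kappa)\mathcal{L}(t,\kappa)G$. $\mathcal{I}(t,\Omega,\epsilon)=\mathcal{T}(t,\eta)[c+\lambda(t,\Omega,\eta)G\mathbf{B}_p]$ with $\eta=\eta(t,\Omega,\epsilon)$, represented with center $\mathcal{T}(t,\eta)c$ and generator matrix $\lambda(t,\Omega,\eta)\mathcal{T}(t,\eta)G$. *)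

(* Defs.v *)
From HB Require Import structures.
From mathcomp Require Import all_boot all_order all_algebra.
From mathcomp Require Import all_classical all_reals all_analysis.
From mathcomp Require Import complex.
From Stdlib Require Import ClassicalEpsilon.
Set Implicit Arguments. Unset Strict Implicit. Unset Printing Implicit Defensive.
Import Order.TTheory GRing.Theory Num.Theory.
Import numFieldNormedType.Exports.
Local Open Scope classical_set_scope.
Local Open Scope ring_scope.

Section Defs.
Context (R : realType).

(* least natural number satisfying P (arbitrary if there is none) *)
Definition nat_min (P : nat -> Prop) : nat :=
  epsilon (inhabits 0%N) (fun k => P k /\ forall m, P m -> (k <= m)%N).

Definition is_norm k (f : 'cV[R]_k -> R) : Prop :=
  [/\ forall x, f x = 0 -> x = 0,
      forall (a : R) x, f (a *: x) = `|a| * f x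
    & forall x y, f (x + y) <= f x + f y].

Variable nrm : forall k, 'cV[R]_k -> R.

Definition uball k : set 'cV[R]_k := [set x | nrm x <= 1].

Definition opnorm m n (M : 'M[R]_(m, n)) : R :=
  sup [set nrm (M *m x) | x in @uball n].

Definition penrose m n (G : 'M[R]_(m, n)) (X : 'M[R]_(n, m)) : Prop :=
  [/\ G *m X *m G = G, X *m G *m X = X,
      (G *m X)^T = G *m X & (X *m G)^T = X *m G].
Definition mpinv m n (G : 'M[R]_(m, n)) : 'M[R]_(n, m) :=
  epsilon (inhabits 0) (penrose G).

Definition specrad n (A : 'M[R]_n) : R :=
  sup [set complex.Re `|l| | l in
        [set l : R[i] | eigenvalue (map_mx (fun x : R => (x%:C)%C) A) l]].

Definition expmx n (M : 'M[R]_n) : 'M[R]_n :=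
  limn (fun m => \sum_(j < m) (j`!%:R)^-1 *: M ^+ j).

Definition vint n (t : R) (f : R -> 'cV[R]_n) : 'cV[R]_n :=
  \col_i (\int[lebesgue_measure]_(s in `[0, t]) f s i ord0).
Definition mint n (t : R) (f : R -> 'M[R]_n) : 'M[R]_n :=
  \matrix_(i, j) (\int[lebesgue_measure]_(s in `[0, t]) f s i j).

Definition minksum n (X Y : set 'cV[R]_n) : set 'cV[R]_n :=
  [set x + y | x in X & y in Y].
Definition mimg m n (M : 'M[R]_(m, n)) (X : set 'cV[R]_n) : set 'cV[R]_m :=
  [set M *m x | x in X].

Fixpoint accum n (V : nat -> set 'cV[R]_n) (i : nat) : set 'cV[R]_n :=
  match i with
  | 0%N => [set 0]
  | i'.+1 => minksum (accum V i') (V i')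
  end.

Record zono n := Zono { zp : nat; zc : 'cV[R]_n; zG : 'M[R]_(n, zp) }.
Definition zset n (Om : zono n) : set 'cV[R]_n :=
  [set zc Om + zG Om *m x | x in @uball (zp Om)].
Definition inA n (Om : zono n) : Prop := \rank (zG Om) = n.

Section WithA.
Variables (n : nat) (A : 'M[R]_n).

Definition Lmx (t : R) (k : nat) : 'M[R]_n :=
  \sum_(j < k) (j`!%:R)^-1 *: (t *: A) ^+ j.
Definition Tmx (t : R) (k : nat) : 'M[R]_n :=
  \sum_(j < k) (t ^+ j.+1 / (j.+1)`!%:R) *: A ^+ j.
Definition theta (r : R) (k : nat) : R :=
  limn (fun m => \sum_(k <= j < m) r ^+ j / (j`!%:R)).

Definition lam (t : R) (Om : zono n) (k : nat) : R :=
  let a := expR (t * opnorm A) * theta (t * opnorm A) k in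
  (1 - a * opnorm (mpinv (zG Om)) * nrm (zc Om)) /
  (1 + a * opnorm (mpinv (zG Om)) * opnorm (zG Om)).

Definition kmin (t : R) : nat :=
  nat_min (fun k => theta (t * specrad A) k * expR (t * specrad A) < 1).

Definition kappa (t : R) (Om : zono n) (e : R) : nat :=
  nat_min (fun k => (maxn (kmin t) 2 <= k)%N /\ e < lam t Om k).

Definition eta_idx (t : R) (Om : zono n) (e : R) : nat :=
  nat_min (fun k => e < lam t Om k /\ Tmx t k \in unitmx).

Definition Hz (t : R) (Om : zono n) (e : R) : zono n :=
  let k := kappa t Om e in
  @Zono n (zp Om) (Lmx t k *m zc Om) (lam t Om k *: (Lmx t k *m zG Om)).
Definition Iz (t : R) (Om : zono n) (e : R) : zono n :=
  let k := eta_idx t Om e in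
  @Zono n (zp Om) (Tmx t k *m zc Om) (lam t Om k *: (Tmx t k *m zG Om)).

Definition inI (t : R) : Prop :=
  0 <= t /\ mint t (fun s => expmx (s *: A)) \in unitmx.

Definition reach_h (X0 : set 'cV[R]_n) (t : R) : set 'cV[R]_n :=
  mimg (expmx (t *: A)) X0.
Definition msel (t : R) (U : set 'cV[R]_n) (w : R -> 'cV[R]_n) : Prop :=
  (forall s, `[0, t]%classic s -> U (w s)) /\
  (forall i, measurable_fun `[0, t] (fun s => w s i ord0)).
Definition reach_u (U : set 'cV[R]_n) (t : R) : set 'cV[R]_n :=
  [set vint t (fun s => expmx (s *: A) *m w s) | w in msel t U].
Definition reach (X0 U : set 'cV[R]_n) (t : R) : set 'cV[R]_n :=
  minksum (reach_h X0 t) (reach_u U t).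
Definition reach_int (X0 U : set 'cV[R]_n) (T : R) : set 'cV[R]_n :=
  \bigcup_(t in `[0, T]) reach X0 U t.

End WithA.
End Defs.

(* Main.v *)
(* The defect of the truncation, x - e^{-sA} L(s,k) x, equals e^{-sA} times the
   tail of the exponential series at x, so its norm is at most
   e^{t|A|} theta(t|A|,k) |x| for 0 <= s <= t.  As G has full row rank, the defect
   is G times a vector of controlled norm, and lambda(t,Omega,k) is precisely the
   factor by which the ball must shrink to absorb it:
   e^{-sA} L(s,k) (c + lambda G b) lies in Omega = c + G B for every s <= t.
   With s = t this gives H(t,Omega) <= e^{tA} Omega.  Since T(t,k) is the integral
   of L(s,k) over [0,t], the function s |-> e^{-sA} L(s,k) x is an admissible
   selection whose trajectory ends at T(t,k) x, which gives I(t,U) <= R_u(t).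
   The condition k >= k_min keeps L(t,k) invertible, so that H stays in A_n: if
   L(t,k) is singular, the truncated exponential vanishes at t mu for some
   eigenvalue mu of A, so the tail at t mu equals e^{t mu}, against the definition
   of k_min.
   On the exact side, R_u(a + b) = R_u(a) + e^{aA} R_u(b) by concatenating
   selections and translating the integral. *)

Require Import Defs.
From HB Require Import structures.
From mathcomp Require Import all_boot all_order all_algebra.
From mathcomp Require Import all_classical all_reals all_analysis.
From mathcomp Require Import complex measurable_realfun.
From mathcomp Require Import ring lra.
From Stdlib Require Import ClassicalEpsilon.
Set Implicit Arguments. Unset Strict Implicit. Unset Printing Implicit Defensive.
Import Order.TTheory GRing.Theory Num.Theory.
Import numFieldNormedType.Exports.
Local Open Scope classical_set_scope.
Local Open Scope ring_scope.

(** * Norms on finite-dimensional spaces *)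

Section MatrixSupNorm.
Context {R : realType}.

Lemma mx_norm_le m n (M : 'M[R]_(m, n)) (C : R) : 0 <= C ->
  (forall i j, `|M i j| <= C) -> `|M| <= C.
Proof.
move=> C0 MC; rewrite [leLHS]/Num.norm/= mx_normrE.
by apply: bigmax_le => // -[i j] _ /=; exact: MC.
Qed.

Lemma entry_le_mx_norm m n (M : 'M[R]_(m, n)) i j : `|M i j| <= `|M|.
Proof.
rewrite [leRHS]/Num.norm/= mx_normrE.
exact: (le_bigmax _ (fun ij : 'I_m * 'I_n => `|M ij.1 ij.2|) (i, j)).
Qed.

Lemma trmx_norm m n (M : 'M[R]_(m, n)) : `|M^T| = `|M|.
Proof.
apply/eqP; rewrite eq_le; apply/andP; split; apply: mx_norm_le => // i j.
  by rewrite mxE entry_le_mx_norm.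
by have := entry_le_mx_norm M^T j i; rewrite mxE.
Qed.

Lemma mulmx_norm_le m n p (M : 'M[R]_(m, n)) (N : 'M[R]_(n, p)) :
  `|M *m N| <= n%:R * `|M| * `|N|.
Proof.
apply: mx_norm_le => [|i j]; first by rewrite !mulr_ge0.
rewrite mxE (le_trans (ler_norm_sum _ _ _))//.
have -> : n%:R * `|M| * `|N| = \sum_(k < n) `|M| * `|N|.
  by rewrite sumr_const card_ord -mulrA mulr_natl.
by apply: ler_sum => k _; rewrite normrM ler_pM// entry_le_mx_norm.
Qed.

End MatrixSupNorm.

Section VectorNorm.
Context {R : realType} {k : nat} (f : 'cV[R]_k -> R).
Hypothesis fnorm : is_norm f.

Lemma is_norm0 : f 0 = 0.
Proof. by case: fnorm => _ fZ _; rewrite -(scale0r 0) fZ normr0 mul0r. Qed.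

Lemma is_normN x : f (- x) = f x.
Proof. by case: fnorm => _ fZ _; rewrite -scaleN1r fZ normrN normr1 mul1r. Qed.

Lemma is_norm_ge0 x : 0 <= f x.
Proof.
case: (fnorm) => _ _ /(_ x (- x)).
by rewrite subrr is_norm0 is_normN; lra.
Qed.

Lemma is_norm_sum I (r : seq I) (P : pred I) (F : I -> 'cV[R]_k) :
  f (\sum_(i <- r | P i) F i) <= \sum_(i <- r | P i) f (F i).
Proof.
elim/big_rec2 : _ => [|i y1 y2 _ h]; first by rewrite is_norm0.
by case: (fnorm) => _ _ fD; rewrite (le_trans (fD _ _))// lerD2l.
Qed.

Lemma is_norm_distl x y : `|f x - f y| <= f (x - y).
Proof.
case: (fnorm) => _ _ fD; rewrite ler_norml; apply/andP; split.
  have := fD (y - x) x; rewrite subrK.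
  have -> : f (y - x) = f (x - y) by rewrite -is_normN opprB.
  lra.
by have := fD (x - y) y; rewrite subrK; lra.
Qed.

(** Expanding in the standard basis, the sum of the norms of the basis vectors serves as the
    constant. *)
Lemma is_norm_le_mx_norm : exists2 C : R, 0 <= C & forall x, f x <= C * `|x|.
Proof.
exists (\sum_i f (delta_mx i 0)) => [|x].
  by apply: sumr_ge0 => i _; exact: is_norm_ge0.
rewrite {1}(matrix_sum_delta x) (le_trans (is_norm_sum _ _ _))// mulr_suml.
apply: ler_sum => i _; rewrite big_ord1.
case: (fnorm) => _ -> _; rewrite mulrC ler_wpM2l ?is_norm_ge0//.
exact: entry_le_mx_norm.
Qed.

(** Equivalence of norms: [f] is continuous for the sup norm, so it attains a positive minimum on
    the compact unit sphere; the constant is the inverse of that minimum. *)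
Lemma mx_norm_le_is_norm : exists2 C : R, 0 <= C & forall x, `|x| <= C * f x.
Proof.
have [C C0 fC] := is_norm_le_mx_norm.
(* Transposed, because compactness and the extreme value theorem are applied among row vectors. *)
pose g (v : 'rV[R]_k) := f v^T.
have gc : continuous g.
  move=> v; apply/(@cvgrPdist_le _ _ _ _ (@nbhs_filter _ v)) => e e0.
  near=> w; rewrite /g (le_trans (is_norm_distl _ _))// -raddfB/=.
  rewrite (le_trans (fC _))//.
  rewrite trmx_norm.
  have : `|v - w| <= e / (C + 1).
    near: w; apply/nbhs_ballP; exists (e / (C + 1)) => /=.
      by rewrite divr_gt0// ltr_wpDl.
    by move=> w; rewrite mx_norm_ball /ball_/= => /ltW.
  rewrite ler_pdivlMr ?ltr_wpDl// => h; apply: le_trans h.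
  by rewrite mulrC ler_wpM2l// lerDl.
pose S : set 'rV[R]_k := [set v | `|v| = 1].
have Scompact : compact S.
  apply: bounded_closed_compact.
    by exists 1; split => // M M1 v /= ->; exact: ltW.
  have -> : S = (fun v : 'rV[R]_k => `|v|) @^-1` [set 1] by [].
  apply: closed_comp; last exact: closed_eq.
  by move=> ? _; exact: norm_continuous.
have normalize (x : 'cV[R]_k) : x != 0 -> S (`|x|^-1 *: x^T).
  move=> x0; rewrite /S/= normrZ ger0_norm ?invr_ge0// trmx_norm mulVf//.
  by rewrite normr_eq0.
(* An empty sphere means that the space is trivial, and then any constant works. *)
have [[x0 xS]|S0] := pselect (S !=set0); last first.
  exists 0 => // x; rewrite mul0r; have [->|x0] := eqVneq x 0.
    by rewrite normr0.
  by exfalso; apply: S0; eexists; exact: (normalize x x0).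
have S0 : S !=set0 by exists x0.
have [c cS cmin] := @EVT_min_rV R k g S S0 Scompact (continuous_subspaceT gc).
have gc0 : 0 < g c.
  rewrite lt_neqAle is_norm_ge0 andbT eq_sym; apply/eqP => gc0.
  have c0 : c^T = 0 by case: (fnorm) => /(_ _ gc0).
  move: cS; rewrite inE /S/= -(trmxK c) c0 trmx0 normr0 => /esym/eqP.
  by rewrite oner_eq0.
exists (g c)^-1 => [|x]; first by rewrite invr_ge0 ltW.
have [->|xn0] := eqVneq x 0; first by rewrite normr0 is_norm0 mulr0.
have := cmin _ (mem_set (normalize x xn0)).
rewrite {2}/g linearZ/= trmxK; case: (fnorm) => _ -> _.
rewrite ger0_norm ?invr_ge0// mulrC ler_pdivlMr ?normr_gt0//.
by rewrite -ler_pdivlMl.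
Unshelve. all: by end_near. Qed.

End VectorNorm.

(** * Operator norms *)

Section OperatorNorm.
Context {R : realType} (nrm : forall k, 'cV[R]_k -> R).
Hypothesis nrmP : forall k, is_norm (@nrm k).

(** [sup] carries information only for a nonempty bounded set; equivalence with the sup norm on both
    sides gives the bound. *)
Lemma opnorm_has_sup m n (M : 'M[R]_(m, n)) :
  has_sup [set nrm (M *m x) | x in @uball R (@nrm) n].
Proof.
split; first by exists (nrm (M *m 0)), 0; rewrite //= /uball/= is_norm0.
have [C C0 hC] := is_norm_le_mx_norm (nrmP m).
have [D D0 hD] := mx_norm_le_is_norm (nrmP n).
exists (C * (n%:R * `|M| * D)) => _ [x xb <-].
rewrite (le_trans (hC _))// ler_wpM2l// (le_trans (mulmx_norm_le _ _))//.
rewrite ler_wpM2l ?mulr_ge0// (le_trans (hD _))//.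
by rewrite -[leRHS]mulr1 ler_wpM2l.
Qed.

Lemma opnorm_ge0 m n (M : 'M[R]_(m, n)) : 0 <= opnorm (@nrm) M.
Proof.
apply: (sup_upper_bound (opnorm_has_sup M)); exists 0; rewrite /uball/= ?is_norm0//.
by rewrite mulmx0 is_norm0.
Qed.

Lemma opnormP m n (M : 'M[R]_(m, n)) x : nrm (M *m x) <= opnorm (@nrm) M * nrm x.
Proof.
have [->|x0] := eqVneq x 0; first by rewrite mulmx0 !is_norm0// mulr0.
have nx0 : 0 < nrm x.
  rewrite lt_neqAle is_norm_ge0// andbT eq_sym; apply/eqP => nx0.
  by case: (nrmP n) => /(_ _ nx0) /eqP; rewrite (negbTE x0).
have /(sup_upper_bound (opnorm_has_sup M)) : [set nrm (M *m y) | y in @uball R (@nrm) n]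
    (nrm (M *m ((nrm x)^-1 *: x))).
  exists ((nrm x)^-1 *: x) => //; rewrite /uball/=.
  case: (nrmP n) => _ -> _; rewrite ger0_norm ?invr_ge0 ?is_norm_ge0//.
  by rewrite mulVf// gt_eqF.
rewrite -scalemxAr; case: (nrmP m) => _ -> _.
by rewrite ger0_norm ?invr_ge0 ?is_norm_ge0// mulrC ler_pdivrMr.
Qed.

End OperatorNorm.

(** * The pseudoinverse of a matrix of full row rank *)

Section PseudoInverse.
Context {R : realType}.

(** A row vector $v$ with $vGG^T=0$ has $(vG)(vG)^T=0$, a sum of squares, so $vG=0$ and $v=0$. *)
Lemma gram_unitmx m n (G : 'M[R]_(m, n)) : row_free G -> G *m G^T \in unitmx.
Proof.
move=> /row_free_inj Ginj; rewrite -row_free_unit -kermx_eq0.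
apply/eqP/row_matrixP => i; rewrite row0.
set v := row i _.
have vK : v *m (G *m G^T) = 0 by rewrite -row_mul mulmx_ker row0.
have : (v *m G) *m (v *m G)^T = 0.
  by rewrite trmx_mul mulmxA -(mulmxA v) vK mul0mx.
move=> /matrixP/(_ 0 0); rewrite !mxE => /eqP.
rewrite psumr_eq0; last by move=> j _; rewrite !mxE -expr2 sqr_ge0.
move=> /allP vG; apply: (Ginj 1%N).
rewrite mul0mx; apply/rowP => j; rewrite [RHS]mxE.
have := vG j (mem_index_enum j); rewrite [(_ *m _)^T _ _]mxE -expr2.
by rewrite sqrf_eq0 => /eqP.
Qed.

Lemma mulmx_mpinv m n (G : 'M[R]_(m, n)) : \rank G = m -> G *m mpinv G = 1%:M.
Proof.
move=> rG; have Gfree : row_free G by apply/eqP.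
have Gu := gram_unitmx Gfree.
have [] : penrose G (mpinv G).
  (* The explicit inverse $G^T(GG^T)^{-1}$ shows that the choice in [mpinv] has a candidate. *)
  apply: epsilon_spec; exists (G^T *m invmx (G *m G^T)).
  split; rewrite ?mulmxA ?mulmxV// ?mul1mx//.
  - by rewrite -(mulmxA _ G) -(mulmxA G^T) mulVmx// mulmx1.
  - by rewrite trmx1.
  - by rewrite !trmx_mul trmxK trmx_inv trmx_mul trmxK mulmxA.
move=> GXG _ _ _; apply: (row_free_inj Gfree).
by rewrite GXG mul1mx.
Qed.

End PseudoInverse.

(** * Exponential sums *)

Section ExponentialSums.

(** The second sum runs through the triangle $i+j<m$ by its diagonals $k=i+j$; removing it from the
    square leaves the pairs with $m\le i+j$. *)
Lemma sum_square_triangle (V : zmodType) (F : nat -> nat -> V) m :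
  \sum_(i < m) \sum_(j < m) F j i - \sum_(k < m) \sum_(i < k.+1) F (k - i)%N i =
  \sum_(i < m) \sum_(j < m | (m <= i + j)%N) F j i.
Proof.
suff -> : \sum_(k < m) \sum_(i < k.+1) F (k - i)%N i =
    \sum_(i < m) \sum_(j < m | (i + j < m)%N) F j i.
  apply/eqP; rewrite subr_eq -big_split/=; apply/eqP/eq_bigr => i _.
  rewrite (bigID (fun j : 'I_m => (m <= i + j)%N))/=; congr (_ + _).
  by apply: eq_bigl => j; rewrite ltnNge.
transitivity (\sum_(k < m) \sum_(i < m | (i <= k)%N) F (k - i)%N i).
  apply: eq_bigr => k _.
  by rewrite (big_ord_widen m (fun i => F (k - i)%N i)) ?ltn_ord.
rewrite (exchange_big_dep xpredT)//=; apply: eq_bigr => i _.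
transitivity (\sum_(i <= k < m) F (k - i)%N i).
  by rewrite big_geq_mkord.
rewrite -{1}(add0n (val i)) big_addn big_mkord.
rewrite (big_ord_widen_cond m xpredT (fun j => F (j + i - i)%N i)) ?leq_subr//.
apply: eq_big => j; first by rewrite /= ltn_subRL.
by move=> _; rewrite addnK.
Qed.

Context {R : realType}.

(** The partial sums whose limit is [expmx M]; [Lmx A t k] unfolds to [pexp (t *: A) k]. *)
Definition pexp n (M : 'M[R]_n) k : 'M[R]_n :=
  \sum_(j < k) (j`!%:R)^-1 *: M ^+ j.

Definition sexp (r : R) k : R := \sum_(j < k) r ^+ j / j`!%:R.

Lemma pexpS n (M : 'M[R]_n) k : pexp M k.+1 = pexp M k + (k`!%:R)^-1 *: M ^+ k.
Proof. exact: big_ord_recr. Qed.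

Lemma sexpS r k : sexp r k.+1 = sexp r k + r ^+ k / k`!%:R.
Proof. exact: big_ord_recr. Qed.

Lemma sexpE r k : sexp r k = series (exp_coeff r) k.
Proof. by rewrite /series/= big_mkord. Qed.

Lemma sexp_cvg (r : R) : sexp r @ \oo --> expR r.
Proof.
rewrite (_ : sexp r = series (exp_coeff r)); last by apply/funext => k; exact: sexpE.
exact: is_cvg_series_exp_coeff.
Qed.

Lemma sexp_homo (r : R) k m : 0 <= r -> (k <= m)%N -> sexp r k <= sexp r m.
Proof.
move=> r0; elim: m => [|m ih]; first by rewrite leqn0 => /eqP ->.
rewrite leq_eqVlt => /orP[/eqP->//|]; rewrite ltnS => /ih h.
by rewrite sexpS (le_trans h)// lerDl divr_ge0// exprn_ge0.
Qed.

Lemma sexp_le_expR (r : R) k : 0 <= r -> sexp r k <= expR r.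
Proof.
move=> r0; have <- := cvg_lim (@Rhausdorff R) (@sexp_cvg r).
apply: limr_ge; first by apply/cvg_ex; exists (expR r); exact: sexp_cvg.
by near=> m; apply: sexp_homo => //; near: m; exact: nbhs_infty_ge.
Unshelve. all: by end_near. Qed.

(** This turns the binomial expansion of a power of a sum into terms of a Cauchy product. *)
Lemma inv_fact_bin k i : (i <= k)%N ->
  (k`!%:R : R)^-1 * 'C(k, i)%:R = ((k - i)`!%:R)^-1 * (i`!%:R)^-1.
Proof.
move=> ik; have h : 'C(k, i)%:R * (i`!%:R * (k - i)`!%:R) = k`!%:R :> R.
  by rewrite -!natrM bin_fact.
have f0 j : j`!%:R != 0 :> R by rewrite pnatr_eq0 -lt0n fact_gt0.
rewrite -h; have : 'C(k, i)%:R != 0 :> R by rewrite pnatr_eq0 -lt0n bin_gt0.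
by move=> c0; field; rewrite c0 !f0.
Qed.

Lemma sexpD (r s : R) k :
  sexp (r + s) k = \sum_(l < k) \sum_(i < l.+1)
    (r ^+ (l - i) / (l - i)`!%:R) * (s ^+ i / i`!%:R).
Proof.
apply: eq_bigr => l _; rewrite exprDn mulr_suml; apply: eq_bigr => i _.
rewrite -mulr_natr -!mulrA [_ / l`!%:R]mulrC inv_fact_bin -1?ltnS//.
by ring.
Qed.

Lemma pexpD n (M N : 'M[R]_n) k : M *m N = N *m M ->
  pexp (M + N) k = \sum_(l < k) \sum_(i < l.+1)
    ((l - i)`!%:R^-1 *: M ^+ (l - i)) *m (i`!%:R^-1 *: N ^+ i).
Proof.
move=> MN; apply: eq_bigr => l _; rewrite GRing.exprDn_comm// scaler_sumr.
apply: eq_bigr => i _; rewrite -scalemxAl -scalemxAr.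
have il : (i <= l)%N by rewrite -ltnS.
rewrite [RHS](scalerA _ _ (M ^+ (l - i) *m N ^+ i : 'M[R]_n)).
by rewrite -inv_fact_bin// -scalerA scaler_nat.
Qed.

Lemma exprmxZ n (M : 'M[R]_n) s j : (s *: M) ^+ j = s ^+ j *: M ^+ j.
Proof.
elim: j => [|j ih]; first by rewrite !expr0 scale1r.
rewrite !exprS ih -[LHS]/((s *: M) *m (s ^+ j *: M ^+ j)).
by rewrite -scalemxAl -scalemxAr scalerA.
Qed.

(* The sup norm of matrices is not submultiplicative, but [n%:R * `|M|] is. *)
Lemma exprn_norm_le n (M : 'M[R]_n) j : `|M ^+ j| <= (n%:R * `|M|) ^+ j.
Proof.
elim: j => [|j ih].
  rewrite !expr0; apply: mx_norm_le => // a b; rewrite mxE.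
  by case: (_ == _); rewrite ?normr1 ?normr0.
rewrite !exprS (le_trans (mulmx_norm_le _ _))// ler_wpM2l// mulr_ge0//.
Qed.

Lemma cvg_mx m n (u : nat -> 'M[R]_(m, n)) (M : 'M[R]_(m, n)) :
  (forall i j, (fun k => u k i j) @ \oo --> M i j) -> u @ \oo --> M.
Proof.
move=> uM; apply/cvgrPdist_le => e e0.
have H : \forall k \near \oo, forall ij : 'I_m * 'I_n,
    `|M ij.1 ij.2 - u k ij.1 ij.2| <= e.
  apply: filter_forall => ij.
  by have /cvgrPdist_le := uM ij.1 ij.2; exact.
near=> k; apply: mx_norm_le => [|i j]; first exact: ltW.
have kH : forall ij : 'I_m * 'I_n, `|M ij.1 ij.2 - u k ij.1 ij.2| <= e.
  by near: k.
by rewrite !mxE; exact: (kH (i, j)).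
Unshelve. all: by end_near. Qed.

(** Each entry is a series dominated by the exponential series at $n|M|$, hence absolutely
    convergent. *)
Lemma pexp_cvg n (M : 'M[R]_n) : pexp M @ \oo --> expmx M.
Proof.
(* [expmx M] is the [limn] of these sums, so it suffices that some limit exists. *)
apply/cvg_ex => /=.
suff H i j : cvgn (fun k => pexp M k i j).
  exists (\matrix_(i, j) limn (fun k => pexp M k i j)).
  by apply: cvg_mx => i j; rewrite mxE; exact: H.
pose b := n%:R * `|M|; have b0 : 0 <= b by rewrite mulr_ge0.
pose u k := (M ^+ k) i j / k`!%:R.
rewrite (_ : (fun k => _) = series u); last first.
  apply/funext => k; rewrite /series/= big_mkord /pexp summxE.
  by apply: eq_bigr => l _; rewrite mxE mulrC.
apply: normed_cvg; apply: series_le_cvg (is_cvg_series_exp_coeff b) => k //=.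
  exact: exp_coeff_ge0.
rewrite /u /exp_coeff/= normrM [X in _ * X]ger0_norm ?invr_ge0// ler_wpM2r ?invr_ge0//.
exact: le_trans (entry_le_mx_norm _ _ _) (exprn_norm_le _ _).
Qed.

(* Both differences collect the terms of the Cauchy square with [m <= i + j]; the
   scalar remainder tends to [expR b * expR c - expR (b + c) = 0]. *)
Lemma pexp_mul_norm_le n (M N : 'M[R]_n) m : M *m N = N *m M ->
  `|pexp M m *m pexp N m - pexp (M + N) m| <=
  n%:R * (sexp (n%:R * `|M|) m * sexp (n%:R * `|N|) m -
          sexp (n%:R * `|M| + n%:R * `|N|) m).
Proof.
move=> MN; set b := n%:R * `|M|; set c := n%:R * `|N|; rewrite pexpD// sexpD.
have -> : pexp M m *m pexp N m = \sum_(i < m) \sum_(j < m)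
    (j`!%:R^-1 *: M ^+ j) *m (i`!%:R^-1 *: N ^+ i).
  rewrite mulmx_sumr; apply: eq_bigr => i _; exact: mulmx_suml.
rewrite (sum_square_triangle
  (fun j i => (j`!%:R^-1 *: M ^+ j) *m (i`!%:R^-1 *: N ^+ i))).
have -> : sexp b m * sexp c m = \sum_(i < m) \sum_(j < m)
    (b ^+ j / j`!%:R) * (c ^+ i / i`!%:R).
  rewrite mulr_sumr; apply: eq_bigr => i _; exact: mulr_suml.
rewrite (sum_square_triangle (fun j i => (b ^+ j / j`!%:R) * (c ^+ i / i`!%:R))).
rewrite mulr_sumr (le_trans (ler_norm_sum _ _ _))//; apply: ler_sum => i _.
rewrite mulr_sumr (le_trans (ler_norm_sum _ _ _))//; apply: ler_sum => j _.
rewrite (le_trans (mulmx_norm_le _ _))// -mulrA ler_wpM2l//.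
by rewrite ler_pM// normrZ mulrC ger0_norm ?invr_ge0// ler_wpM2r ?invr_ge0//
  exprn_norm_le.
Qed.

Lemma cvg_mx_entry m n (u : nat -> 'M[R]_(m, n)) (M : 'M[R]_(m, n)) i j :
  u @ \oo --> M -> (fun k => u k i j) @ \oo --> M i j.
Proof.
move=> uM; have := @coord_continuous R m n i j M.
exact: (@cvg_comp _ _ _ u (fun N : 'M[R]_(m, n) => N i j) _ _ _ uM).
Qed.

Lemma cvg_mulmx m n p (u : nat -> 'M[R]_(m, n)) (v : nat -> 'M[R]_(n, p))
    (M : 'M[R]_(m, n)) (N : 'M[R]_(n, p)) :
  u @ \oo --> M -> v @ \oo --> N -> (fun k => u k *m v k) @ \oo --> M *m N.
Proof.
move=> uM vN; apply: cvg_mx => i j; rewrite mxE.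
rewrite (_ : (fun k => _) = fun k => \sum_l u k i l * v k l j); last first.
  by apply/funext => k; rewrite mxE.
apply: cvg_big => [|l _]; [exact: add_continuous|apply: cvgM]; exact: cvg_mx_entry.
Qed.

(** Entries of the difference of truncations are squeezed to 0 by the scalar remainder, which
    vanishes in the limit since $e^be^c=e^{b+c}$. *)
Lemma expmxD n (M N : 'M[R]_n) : M *m N = N *m M ->
  expmx (M + N) = expmx M *m expmx N.
Proof.
move=> MN; set b := n%:R * `|M|; set c := n%:R * `|N|.
have h1 := cvg_mulmx (@pexp_cvg n M) (@pexp_cvg n N).
have h2 := @pexp_cvg n (M + N).
have h3 : n%:R * (sexp b m * sexp c m - sexp (b + c) m) @[m --> \oo] --> (0 : R).
  rewrite -(mulr0 n%:R) -(subrr (expR (b + c))) {1}expRD.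
  apply: cvgM; first exact: cvg_cst.
  by apply: cvgB; [apply: cvgM|]; exact: sexp_cvg.
apply/esym/matrixP => i j; apply/eqP; rewrite -subr_eq0; apply/eqP.
have h4 := cvgB (@cvg_mx_entry _ _ _ _ i j h1) (@cvg_mx_entry _ _ _ _ i j h2).
suff h5 : (pexp M m *m pexp N m) i j - pexp (M + N) m i j @[m --> \oo] --> (0 : R).
  exact: (norm_cvg_unique (h4 _) h5).
apply: norm_cvg0; apply: (squeeze_cvgr _ (cvg_cst (0 : R)) h3).
near=> m; rewrite normr_ge0/=.
have := @pexp_mul_norm_le n M N m MN; apply: le_trans.
by have := entry_le_mx_norm (pexp M m *m pexp N m - pexp (M + N) m) i j;
  rewrite !mxE.
Unshelve. all: by end_near. Qed.

Lemma expmx0 n : expmx (0 : 'M[R]_n) = 1%:M.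
Proof.
suff h : pexp (0 : 'M[R]_n) @ \oo --> (1%:M : 'M[R]_n).
  exact: (norm_cvg_unique (@pexp_cvg n 0) h).
(* The empty sum at index 0 is 0 instead of the identity; the shift skips it. *)
rewrite -(@cvg_shiftS 'M[R]_n).
rewrite (_ : (fun k => _) = fun=> 1%:M); first exact: cvg_cst.
apply/funext => k; rewrite /pexp big_ord_recl big1 => [|i _].
  by rewrite addr0 expr0 fact0 invr1 scale1r.
by rewrite exprS mul0r scaler0.
Qed.

Lemma expmxDZ n (A : 'M[R]_n) s t :
  expmx ((s + t) *: A) = expmx (s *: A) *m expmx (t *: A).
Proof.
rewrite scalerDl expmxD// -!scalemxAl -!scalemxAr.
by rewrite !scalerA mulrC.
Qed.

Lemma expmxVZ n (A : 'M[R]_n) s : expmx (s *: A) *m expmx (- s *: A) = 1%:M.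
Proof. by rewrite -expmxDZ subrr scale0r expmx0. Qed.

(** Termwise, $M^jx$ has norm at most $r^jf(x)$. Stated for an arbitrary norm, it serves [nrm], the
    sup norm and the modulus on $\mathbb{C}$; with $k=0$ it bounds the exponential itself. *)
Lemma expmx_tail_le n (f : 'cV[R]_n -> R) (M : 'M[R]_n) r k x :
  is_norm f -> 0 <= r -> (forall y, f (M *m y) <= r * f y) ->
  f ((expmx M - pexp M k) *m x) <= (expR r - sexp r k) * f x.
Proof.
move=> fn r0 fM; have [_ fZ fD] := fn.
have fMX j y : f (M ^+ j *m y) <= r ^+ j * f y.
  elim: j y => [|j ih] y; first by rewrite !expr0 mul1mx mul1r.
  rewrite !exprSr -mulmxA (le_trans (ih _))// -mulrA ler_wpM2l ?exprn_ge0//.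
have step d : f ((pexp M (k + d) - pexp M k) *m x) <=
    (sexp r (k + d) - sexp r k) * f x.
  elim: d => [|d ih]; first by rewrite addn0 !subrr mul0mx mul0r is_norm0.
  rewrite addnS pexpS sexpS addrAC mulmxDl [X in _ <= X * _]addrAC mulrDl.
  rewrite (le_trans (fD _ _))// lerD// -scalemxAl fZ.
  by rewrite ger0_norm ?invr_ge0// mulrAC mulrC ler_wpM2r ?invr_ge0.
(* To pass to the limit, the remainder past a far index is made smaller than an arbitrary [e], and
   the finite segment before it is bounded by [step]. *)
have [C C0 fC] := is_norm_le_mx_norm fn.
apply/ler_addgt0Pr => e e0.
have : \forall m \near \oo, C * (n%:R * `|expmx M - pexp M m| * `|x|) <= e.
  have K0 : 0 < C * n%:R * `|x| + 1 by rewrite ltr_wpDl// !mulr_ge0.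
  have /cvgrPdist_le/(_ (e / (C * n%:R * `|x| + 1))) := @pexp_cvg n M.
  rewrite divr_gt0// => /(_ isT); apply: filterS => m.
  rewrite ler_pdivlMr// mulrDr mulr1 => h.
  rewrite (le_trans _ h)//.
  have -> : C * (n%:R * `|expmx M - pexp M m| * `|x|) =
    `|expmx M - pexp M m| * (C * n%:R * `|x|) by ring.
  by rewrite lerDl.
move=> [m0 _ /(_ (k + m0)%N) /= /(_ (leq_addl _ _)) hm].
have -> : expmx M - pexp M k = (pexp M (k + m0) - pexp M k) +
   (expmx M - pexp M (k + m0)) by rewrite [RHS]addrC addrA subrK.
rewrite mulmxDl (le_trans (fD _ _))// lerD//.
  rewrite (le_trans (step _))// ler_wpM2r ?is_norm_ge0// lerD2r.
  exact: sexp_le_expR.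
rewrite (le_trans _ hm)// (le_trans (fC _))// ler_wpM2l//.
exact: mulmx_norm_le.
Qed.

End ExponentialSums.

(** * Truncation indices *)

Section Truncation.
Context {R : realType}.

(** Well-ordering: one witness guarantees a least one, so [epsilon] returns a value with the
    property. *)
Lemma nat_minP (P : nat -> Prop) : (exists k, P k) -> P (nat_min P).
Proof.
move=> [k Pk]; have /= [] // := @epsilon_spec nat (inhabits 0%N)
  (fun k => P k /\ forall m, P m -> (k <= m)%N).
have ex : exists n, `[< P n >] by exists k; apply/asboolP.
case: (ex_minnP ex) => m /asboolP Pm mP; exists m; split => // l Pl.
by apply: mP; apply/asboolP.
Qed.

Lemma thetaE (r : R) k : theta r k = expR r - sexp r k.
Proof.
apply: (cvg_lim (@Rhausdorff R)).
have : sexp r m - sexp r k @[m --> \oo] --> expR r - sexp r k.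
  by apply: cvgB; [exact: sexp_cvg|exact: cvg_cst].
apply: cvg_trans; apply: near_eq_cvg; near=> m.
have km : (k <= m)%N by near: m; exact: nbhs_infty_ge.
rewrite /sexp -!(big_mkord xpredT (fun j => r ^+ j / j`!%:R)).
by rewrite (big_cat_nat (leq0n k) km)/= addrAC subrr add0r.
Unshelve. all: by end_near. Qed.

Lemma theta_cvg0 (r : R) : theta r k @[k --> \oo] --> (0 : R).
Proof.
rewrite (_ : theta r = fun k => expR r - sexp r k); last first.
  by apply/funext => k; exact: thetaE.
rewrite -(subrr (expR r)); apply: cvgB; [exact: cvg_cst|exact: sexp_cvg].
Qed.

Lemma theta_ge0 (r : R) k : 0 <= r -> 0 <= theta r k.
Proof. by move=> r0; rewrite thetaE subr_ge0 sexp_le_expR. Qed.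

Lemma theta_anti (r : R) k m : 0 <= r -> (k <= m)%N -> theta r m <= theta r k.
Proof. by move=> r0 km; rewrite !thetaE lerD2l lerN2 sexp_homo. Qed.

(** Monotonicity is termwise, so the difference in [thetaE] is read again as a limit of segments of
    the series. *)
Lemma theta_homo (r s : R) k : 0 <= r -> r <= s -> theta r k <= theta s k.
Proof.
move=> r0 rs; rewrite !thetaE.
have h (x : R) : sexp x m - sexp x k @[m --> \oo] --> expR x - sexp x k.
  by apply: cvgB; [exact: sexp_cvg|exact: cvg_cst].
have e (x : R) := cvg_lim (@Rhausdorff R) (h x).
rewrite -(e _ r) -(e _ s); apply: ler_lim.
- by apply/cvg_ex; eexists; exact: h.
- by apply/cvg_ex; eexists; exact: h.
near=> m; have km : (k <= m)%N by near: m; exact: nbhs_infty_ge.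
rewrite /sexp -!(big_mkord xpredT (fun j => _ ^+ j / j`!%:R)).
rewrite !(big_cat_nat (leq0n k) km)/= ![_ + _ - _]addrAC !subrr !add0r.
apply: ler_sum => j _; rewrite ler_wpM2r ?invr_ge0//.
by apply: lerXn2r => //; rewrite nnegrE (le_trans r0).
Unshelve. all: by end_near. Qed.

Section Norm.
Variables (nrm : forall k, 'cV[R]_k -> R) (n : nat) (A : 'M[R]_n).

(** The tail tends to 0, so numerator and denominator both tend to 1. Hence every threshold below 1
    is eventually exceeded, and [kappa] is attained. *)
Lemma lam_cvg1 t Om : lam (@nrm) A t Om k @[k --> \oo] --> (1 : R).
Proof.
pose g := opnorm (@nrm) (mpinv (zG Om)).
have a0 : expR (t * opnorm (@nrm) A) * theta (t * opnorm (@nrm) A) k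
    @[k --> \oo] --> (0 : R).
  rewrite -(mulr0 (expR (t * opnorm (@nrm) A))).
  by apply: cvgM; [exact: cvg_cst|exact: theta_cvg0].
have h (c : R) : expR (t * opnorm (@nrm) A) * theta (t * opnorm (@nrm) A) k *
    g * c @[k --> \oo] --> (0 : R).
  rewrite -(mul0r (g * c)); under eq_fun do rewrite -(mulrA _ g).
  by apply: cvgM => //; exact: cvg_cst.
have -> : (1 : R) = (1 - 0) / (1 + 0) by rewrite subr0 addr0 divr1.
rewrite /lam; apply: cvgM; first by apply: cvgB; [exact: cvg_cst|exact: h].
apply: cvgV; first by rewrite addr0 oner_neq0.
by apply: cvgD; [exact: cvg_cst|exact: h].
Qed.

Lemma kmin_spec t : theta (t * specrad A) (kmin A t) * expR (t * specrad A) < 1.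
Proof.
apply: (nat_minP (P := fun k => theta _ k * expR (t * specrad A) < 1)).
have : theta (t * specrad A) k * expR (t * specrad A) @[k --> \oo] --> (0 : R).
  rewrite -(mul0r (expR (t * specrad A))).
  by apply: cvgM; [exact: theta_cvg0|exact: cvg_cst].
move=> /cvgr_lt/(_ _ ltr01) [k _ /(_ k (leqnn k))]; by exists k.
Qed.

Lemma near_lt_lam t Om e : e < 1 -> \forall k \near \oo, e < lam (@nrm) A t Om k.
Proof. by move=> e1; exact: (cvgr_gt _ (@lam_cvg1 t Om)). Qed.

Lemma kappa_spec t Om e : e < 1 ->
  (maxn (kmin A t) 2 <= kappa (@nrm) A t Om e)%N /\
  e < lam (@nrm) A t Om (kappa (@nrm) A t Om e).
Proof.
move=> /near_lt_lam - /(_ t Om)[k _ kP].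
apply: (nat_minP (P := fun k => (maxn _ 2 <= k)%N /\ e < lam _ _ _ _ k)).
exists (maxn k (maxn (kmin A t) 2)); split; first exact: leq_maxr.
by apply: kP; exact: leq_maxl.
Qed.

End Norm.
End Truncation.

(** * Invertibility of the truncated exponential *)

Section ComplexModulus.
Context {R : realType}.

(** The norm on [R[i]] takes values in [R[i]] with zero imaginary part; its real part is the form
    that [specrad] uses. *)
Definition cabs (z : R[i]) : R := complex.Re `|z|.

Lemma cabsE (z : R[i]) : ((cabs z)%:C)%C = `|z|.
Proof. exact/RRe_real/normr_real. Qed.

Lemma cabs_ge0 z : 0 <= cabs z.
Proof. by rewrite -lecR cabsE normr_ge0. Qed.

Lemma cabsM z w : cabs (z * w) = cabs z * cabs w.
Proof. by apply: complexI; rewrite rmorphM/= !cabsE normrM. Qed.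

Lemma cabsR (r : R) : cabs (r%:C)%C = `|r|.
Proof. by apply: complexI; rewrite cabsE normc_def/= expr0n addr0 sqrtr_sqr. Qed.

Lemma cabs1 : cabs 1 = 1.
Proof. by have := cabsR 1; rewrite normr1 rmorph1. Qed.

(* A complex number acts on [R^2] as a 2x2 real matrix, and its modulus is the
   Euclidean norm; this brings power series in a complex argument under the
   bounds for matrix exponentials. *)
Definition cvec (z : R[i]) : 'cV[R]_2 :=
  \col_i (if i == 0 then complex.Re z else complex.Im z).

Definition cmat (z : R[i]) : 'M[R]_2 :=
  \matrix_(i, j) (if i == 0 then if j == 0 then complex.Re z else - complex.Im z
                  else if j == 0 then complex.Im z else complex.Re z).

Definition cnorm (v : 'cV[R]_2) : R := cabs (v 0 0 +i* v 1 0)%C.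

Lemma cnorm_cvec z : cnorm (cvec z) = cabs z.
Proof. by rewrite /cnorm !mxE/=; case: z. Qed.

Lemma cvec_surj (v : 'cV[R]_2) : v = cvec (v 0 0 +i* v 1 0)%C.
Proof.
apply/matrixP => i j; rewrite ord1 mxE; case: i => [[|[|//]] i2] /=; congr (v _ _);
  exact/val_inj.
Qed.

Lemma cvecD z w : cvec (z + w) = cvec z + cvec w.
Proof.
by apply/colP => i; rewrite !mxE; case: z w => [a b] [c d]; case: ifP.
Qed.

Lemma cvecZ (r : R) z : cvec ((r%:C)%C * z) = r *: cvec z.
Proof.
apply/colP => i; rewrite !mxE; case: z => [a b] /=.
by case: ifP => _; rewrite mul0r ?subr0 ?addr0.
Qed.

Lemma cvec0 : cvec 0 = 0.
Proof. by apply/colP => i; rewrite !mxE; case: ifP. Qed.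

Lemma cmatP z w : cmat z *m cvec w = cvec (z * w).
Proof.
apply/colP => i; rewrite !mxE !big_ord_recl big_ord0 addr0 !mxE/=.
by case: z w => [a b] [c d] /=; case: ifP => _; rewrite ?mulNr// addrC.
Qed.

Lemma is_norm_cnorm : is_norm cnorm.
Proof.
split=> [v v0|a v|v w].
- rewrite (cvec_surj v); move: v0; rewrite /cnorm => v0.
  have /eqP := cabsE (v 0 0 +i* v 1 0)%C; rewrite v0 eq_sym normr_eq0 => /eqP ->.
  exact: cvec0.
- by rewrite {1}(cvec_surj v) -cvecZ cnorm_cvec cabsM cabsR.
- rewrite {1}(cvec_surj v) {1}(cvec_surj w) -cvecD cnorm_cvec.
  by rewrite -lecR rmorphD/= !cabsE ler_normD.
Qed.

(** At a root the tail is all of $e^z$, so $|e^z|\le\theta(|z|,k)$; then $1=|e^{-z}e^z|\le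
    e^{|z|}|e^z|$. *)
Lemma exp_sum_root_bound (z : R[i]) k :
  \sum_(j < k) (j`!%:R)^-1 * z ^+ j = 0 ->
  1 <= theta (cabs z) k * expR (cabs z).
Proof.
move=> zk; have cn := is_norm_cnorm; have z0 := cabs_ge0 z.
have matX j w : cmat z ^+ j *m cvec w = cvec (z ^+ j * w).
  elim: j w => [|j ih] w; first by rewrite !expr0 mul1mx mul1r.
  by rewrite !exprSr -mulmxA cmatP ih mulrA.
have zy y : cnorm (cmat z *m y) = cabs z * cnorm y.
  by rewrite (cvec_surj y) cmatP !cnorm_cvec cabsM.
have K0 : pexp (cmat z) k *m cvec 1 = 0.
  rewrite mulmx_suml -[RHS]cvec0 -[in RHS]zk.
  rewrite (big_morph cvec cvecD cvec0); apply: eq_bigr => j _.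
  rewrite -scalemxAl matX mulr1 -cvecZ; congr (cvec (_ * _)).
  by rewrite fmorphV rmorph_nat.
have zley y : cnorm (cmat z *m y) <= cabs z * cnorm y by rewrite zy.
have := expmx_tail_le k (cvec 1) cn z0 zley.
rewrite mulmxBl K0 subr0 -thetaE cnorm_cvec.
rewrite cabs1 mulr1 => h.
have nzy y : cnorm (- cmat z *m y) <= cabs z * cnorm y.
  by rewrite mulNmx is_normN// zy.
(* With no term removed, the tail bound reads $|e^{-z}y|\le e^{|z|}|y|$. *)
have := expmx_tail_le 0 (expmx (cmat z) *m cvec 1) cn z0 nzy.
rewrite /pexp /sexp !big_ord0 !subr0 mulmxA.
have -> : expmx (- cmat z) *m expmx (cmat z) = 1%:M.
  by have := expmxVZ (cmat z) (- 1); rewrite scaleN1r opprK scale1r.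
rewrite mul1mx cnorm_cvec cabs1.
move=> /le_trans; apply; rewrite mulrC ler_wpM2r// ?expR_ge0//.
Qed.

(** The supremum is genuine because the eigenvalues are among the roots of the characteristic
    polynomial; the sum of the moduli of these roots is an upper bound. *)
Lemma eigenvalue_le_specrad n (A : 'M[R]_n) (l : R[i]) :
  eigenvalue (map_mx (fun x : R => (x%:C)%C) A) l -> cabs l <= specrad A.
Proof.
set B := map_mx _ A => Bl.
have sup_ok : has_sup [set complex.Re `|l| | l in
    [set l : R[i] | eigenvalue B l]].
  split; first by exists (cabs l), l.
  have [r rP] := closed_field_poly_normal (char_poly B).
  exists (\sum_(z <- r) cabs z) => _ [m Bm <-].
  have mr : m \in r.
    move: Bm => /=; rewrite eigenvalue_root_char rP.
    rewrite rootZ ?lead_coef_eq0 ?monic_neq0 ?char_poly_monic//.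
    by rewrite root_prod_XsubC.
  rewrite (big_rem m)//= lerDl; apply: sumr_ge0 => z _; exact: cabs_ge0.
by apply: (sup_upper_bound sup_ok); exists l.
Qed.

Lemma specrad_ge0 n (A : 'M[R]_n) : 0 <= specrad A.
Proof.
have [[l Al]|no] := pselect (exists l, eigenvalue (map_mx (fun x : R => (x%:C)%C) A) l).
  exact: le_trans (cabs_ge0 l) (eigenvalue_le_specrad Al).
(* Without eigenvalues the supremum is over the empty set, where [sup] is 0. *)
rewrite /specrad (_ : [set _ | _ in _] = set0) ?sup0//.
by apply/seteqP; split => [x [l Al _]|//]; apply: no; exists l.
Qed.

(** Over $\mathbb{C}$ the matrix is $q(A)$ with $q$ the truncated exponential in $tX$, and $q$
    splits into linear factors. A factor $A-z$ is singular only at an eigenvalue $z$; then $tz$ is a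
    root of the truncated exponential, which [exp_sum_root_bound] excludes. *)
Lemma Lmx_unitmx n (A : 'M[R]_n) t k : 0 <= t -> (0 < k)%N ->
  theta (t * specrad A) k * expR (t * specrad A) < 1 -> Lmx A t k \in unitmx.
Proof.
(* In dimension 0 every determinant is 1; the factorization is carried out in positive dimension. *)
case: n A => [A|n A] t0 k0 h; first by rewrite unitmxE det_mx00 unitr1.
pose C (x : R) := (x%:C)%C.
pose B : 'M[R[i]]_n.+1 := map_mx (real_complex R) A.
pose q : {poly R[i]} := \sum_(j < k) C ((j`!%:R)^-1 * t ^+ j) *: 'X^j.
have LB : map_mx (real_complex R) (Lmx A t k) = horner_mx B q.
  rewrite /Lmx /q raddf_sum/= rmorph_sum/=; apply: eq_bigr => j _.
  rewrite linearZ/= rmorphXn/= horner_mx_X exprZn scalerA.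
  by rewrite map_mxZ rmorphXn.
rewrite -(map_unitmx (real_complex R)) LB.
have [r rP] := closed_field_poly_normal q.
(* The constant coefficient is 1, as $k>0$ keeps the term of degree 0. *)
have q0 : q != 0.
  apply/eqP => /(congr1 (fun p : {poly R[i]} => p.[0])); rewrite horner0.
  rewrite horner_sum (bigD1 (Ordinal k0))//= big1 => [|j j0].
    rewrite hornerZ hornerXn !expr0 fact0 invr1 !mulr1 addr0 => /eqP.
    by rewrite /C rmorph1 oner_eq0.
  by rewrite hornerZ hornerXn expr0n (negbTE (_ : val j != 0%N)) ?mulr0.
have [/hasP[z zr Bz]|/hasPn noeig] := boolP (has (eigenvalue B) r).
  exfalso; have qz : q.[z] = 0.
    rewrite rP hornerZ; apply/eqP; rewrite mulf_eq0; apply/orP; right.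
    by rewrite -rootE root_prod_XsubC.
  have := @exp_sum_root_bound (C t * z) k.
  have -> : \sum_(j < k) (j`!%:R)^-1 * (C t * z) ^+ j = 0.
    rewrite -[RHS]qz horner_sum; apply: eq_bigr => j _.
    rewrite hornerZ hornerXn exprMn mulrA; congr (_ * _).
    by rewrite /C rmorphM rmorphXn fmorphV rmorph_nat.
  rewrite cabsM cabsR ger0_norm// => /(_ erefl); apply/negP; rewrite -ltNge.
  apply: le_lt_trans h; have zA := eigenvalue_le_specrad Bz.
  have tz : t * cabs z <= t * specrad A by rewrite ler_wpM2l.
  apply: ler_pM; rewrite ?expR_ge0 ?ler_expR//.
    by rewrite theta_ge0// mulr_ge0// cabs_ge0.
  by apply: theta_homo => //; rewrite mulr_ge0// cabs_ge0.
rewrite rP linearZ/= rmorph_prod/=.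
have lc : lead_coef q \is a GRing.unit by rewrite unitfE lead_coef_eq0.
rewrite -mul_scalar_mx unitmx_mul; apply/andP; split.
  by rewrite unitmxE det_scalar unitrX.
elim: r {rP} noeig => [|z r ih] noeig; first by rewrite big_nil unitmx1.
rewrite big_cons unitmx_mul; apply/andP; split; last first.
  by apply: ih => w wr; apply: noeig; rewrite inE wr orbT.
rewrite rmorphB/= horner_mx_X horner_mx_C -row_free_unit -kermx_eq0.
by have := noeig z (mem_head _ _); rewrite /eigenvalue negbK.
Qed.

End ComplexModulus.

(** * Truncated flows and their integrals *)

Section Inclusion.
Context {R : realType} (nrm : forall k, 'cV[R]_k -> R) (n : nat) (A : 'M[R]_n).
Hypothesis nrmP : forall k, is_norm (@nrm k).

Let a := opnorm (@nrm) A.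

Lemma opnormZ_le s x : nrm (s *: A *m x) <= `|s| * a * nrm x.
Proof.
rewrite -scalemxAl; case: (nrmP n) => _ -> _.
by rewrite -mulrA ler_wpM2l// opnormP.
Qed.

Lemma flow_defect_le s t k (x : 'cV[R]_n) : 0 <= s <= t ->
  nrm (x - expmx (- s *: A) *m (Lmx A s k *m x)) <=
  expR (t * a) * theta (t * a) k * nrm x.
Proof.
move=> /andP[s0 st]; have a0 : 0 <= a := opnorm_ge0 nrmP A.
have sa0 : 0 <= s * a by rewrite mulr_ge0.
have sata : s * a <= t * a by rewrite ler_wpM2r.
have bnd y : nrm (s *: A *m y) <= s * a * nrm y.
  by rewrite (le_trans (opnormZ_le _ _))// ger0_norm.
have bndN y : nrm (- s *: A *m y) <= s * a * nrm y.
  by rewrite (le_trans (opnormZ_le _ _))// normrN ger0_norm.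
have -> : x - expmx (- s *: A) *m (Lmx A s k *m x) =
    expmx (- s *: A) *m ((expmx (s *: A) - pexp (s *: A) k) *m x).
  rewrite mulmxBl mulmxBr; congr (_ - _).
  have := expmxVZ A (- s); rewrite opprK => e.
  by rewrite mulmxA e mul1mx.
(* Two tail bounds are composed: truncation at 0 bounds $e^{-sA}$, truncation at $k$ bounds the
   remainder. *)
have := expmx_tail_le 0 ((expmx (s *: A) - pexp (s *: A) k) *m x) (nrmP n) sa0 bndN.
rewrite /pexp big_ord0 /sexp big_ord0 !subr0 -/(pexp _ k) => /le_trans; apply.
have := expmx_tail_le k x (nrmP n) sa0 bnd; rewrite -thetaE => h.
rewrite -mulrA ler_pM ?expR_ge0 ?is_norm_ge0 ?ler_expR// (le_trans h)//.
by rewrite ler_wpM2r ?is_norm_ge0// theta_homo.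
Qed.

Lemma flow_back_truncation (Om : zono R n) s t k b :
  inA Om -> 0 <= s <= t -> 0 <= lam (@nrm) A t Om k -> nrm b <= 1 ->
  zset (@nrm) Om (expmx (- s *: A) *m (Lmx A s k *m
    (zc Om + lam (@nrm) A t Om k *: (zG Om *m b)))).
Proof.
move=> OmA st; set l := lam _ _ _ _ _ => l0 b1.
set x := _ + _; have a0 : 0 <= a := opnorm_ge0 nrmP A.
have ta0 : 0 <= t * a.
  by move: st => /andP[s0 st]; rewrite mulr_ge0// (le_trans s0).
set q := expR (t * a) * theta (t * a) k.
have q0 : 0 <= q by rewrite mulr_ge0 ?expR_ge0 ?theta_ge0.
have [_ nZ nD] := nrmP n; have [_ pZ pD] := nrmP (zp Om).
pose d := x - expmx (- s *: A) *m (Lmx A s k *m x).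
have dq : nrm d <= q * nrm x := flow_defect_le k x st.
pose g := opnorm (@nrm) (mpinv (zG Om)); have g0 : 0 <= g := opnorm_ge0 nrmP _.
pose h := opnorm (@nrm) (zG Om); have h0 : 0 <= h := opnorm_ge0 nrmP _.
have xle : nrm x <= nrm (zc Om) + l * h.
  rewrite (le_trans (nD _ _))// lerD2l nZ ger0_norm// ler_wpM2l//.
  rewrite (le_trans (opnormP nrmP _ _))//.
  by rewrite -[leRHS]mulr1 ler_wpM2l.
(* Since $GG^\dagger=1$, this vector represents $c+lGb-d=x-d$, which is $e^{-sA}L(s,k)x$. *)
exists (l *: b - mpinv (zG Om) *m d).
  rewrite /uball/= (le_trans (pD _ _))// is_normN// pZ ger0_norm//.
  (* [l] is the solution of this linear equation *)
  have -> : 1 = l + g * (q * (nrm (zc Om) + l * h)).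
    have qgh0 : 0 <= q * g * h by apply: mulr_ge0 => //; exact: mulr_ge0.
    have den : 1 + q * g * h != 0 by rewrite gt_eqF//; lra.
    have : l * (1 + q * g * h) = 1 - q * g * nrm (zc Om) by exact: divfK.
    by move=> e; rewrite -[LHS](subrK (q * g * nrm (zc Om))) -e; ring.
  apply: lerD; first by rewrite -[leRHS]mulr1 ler_wpM2l.
  rewrite (le_trans (opnormP nrmP _ _))// ler_wpM2l// (le_trans dq)//.
  by rewrite ler_wpM2l.
rewrite mulmxBr (mulmxA _ (mpinv _)) mulmx_mpinv// mul1mx -scalemxAr addrA.
by rewrite -/x subKr.
Qed.

Lemma inA_scale_mul (Om : zono R n) (M : 'M[R]_n) l c :
  inA Om -> M \in unitmx -> l != 0 ->
  inA (@Zono R n (zp Om) c (l *: (M *m zG Om))).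
Proof.
move=> OmA Mu l0; rewrite /inA/= mxrank_scale_nz//.
by rewrite (eqmxMfull (zG Om) _) ?row_full_unit.
Qed.

Lemma Hz_spec t (Om : zono R n) e : 0 <= t -> 0 <= e < 1 -> inA Om ->
  inA (Hz (@nrm) A t Om e) /\
  zset (@nrm) (Hz (@nrm) A t Om e) `<=` mimg (expmx (t *: A)) (zset (@nrm) Om).
Proof.
move=> t0 /andP[e0 e1] OmA; rewrite /Hz.
have [kle elam] := kappa_spec (@nrm) A t Om e1.
set k := kappa _ _ _ _ _ in kle elam *; set l := lam _ _ _ _ _ in elam *.
have l0 : 0 < l by exact: le_lt_trans elam.
move: kle; rewrite geq_max => /andP[kmin_k k2].
split.
  apply: inA_scale_mul => //; last by rewrite gt_eqF.
  apply: Lmx_unitmx; rewrite // ?(ltn_trans _ k2)//.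
  (* The inequality at [kmin] persists at the larger index [k] because tails decrease. *)
  apply: le_lt_trans (kmin_spec A t); rewrite ler_wpM2r ?expR_ge0//.
  by apply: theta_anti => //; rewrite mulr_ge0// specrad_ge0.
move=> _ [b b1 <-] /=.
exists (expmx (- t *: A) *m (Lmx A t k *m (zc Om + l *: (zG Om *m b)))).
  by apply: flow_back_truncation => //; rewrite ?t0 ?lexx// ltW.
by rewrite mulmxA expmxVZ mul1mx mulmxDr -scalemxAr -scalemxAl mulmxA.
Qed.

End Inclusion.

(** * The integral of the truncated exponential *)

Section TruncatedIntegral.
Context {R : realType}.

Lemma is_norm_mx_norm n : is_norm (fun x : 'cV[R]_n => `|x|).
Proof.
split=> [x /eqP|c x|x y]; last exact: ler_normD.
  by rewrite normr_eq0 => /eqP.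
by rewrite normrZ.
Qed.

(** The vector bound for the sup norm, with growth constant $sn|A|$, applied to each standard basis
    vector, that is, to each column. *)
Lemma expmx_tail_norm_le n (A : 'M[R]_n) s k : 0 <= s ->
  `|expmx (s *: A) - pexp (s *: A) k| <= theta (s * (n%:R * `|A|)) k.
Proof.
move=> s0; have b0 : 0 <= s * (n%:R * `|A|) by rewrite !mulr_ge0.
apply: mx_norm_le => [|i j]; first exact: theta_ge0.
have bnd (y : 'cV[R]_n) : `|s *: A *m y| <= s * (n%:R * `|A|) * `|y|.
  by rewrite -scalemxAl normrZ ger0_norm// -mulrA ler_wpM2l// mulmx_norm_le.
have := expmx_tail_le k (delta_mx j 0) (is_norm_mx_norm n) b0 bnd.
rewrite -thetaE; move: (expmx _ - pexp _ _) => M h.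
have : `|delta_mx j 0 : 'cV[R]_n| <= 1.
  apply: mx_norm_le => // u v; rewrite mxE.
  by case: (_ && _); rewrite ?normr1 ?normr0.
move=> d1; have := entry_le_mx_norm (M *m (delta_mx j 0 : 'cV[R]_n)) i 0.
have -> : (M *m (delta_mx j 0 : 'cV[R]_n)) i 0 = M i j.
  rewrite mxE (bigD1 j)//= big1 => [|l lj]; last by rewrite mxE (negbTE lj) mulr0.
  by rewrite mxE !eqxx mulr1 addr0.
move=> /le_trans; apply; rewrite (le_trans h)//.
by rewrite -[leRHS]mulr1 ler_wpM2l// theta_ge0.
Qed.

Lemma expmx_norm_le n (A : 'M[R]_n) s t : 0 <= s <= t ->
  `|expmx (s *: A)| <= expR (t * (n%:R * `|A|)).
Proof.
move=> /andP[s0 st]; have := expmx_tail_norm_le A 0 s0.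
rewrite {1}/pexp big_ord0 subr0 => /le_trans; apply.
by rewrite thetaE /sexp big_ord0 subr0 ler_expR ler_wpM2r// mulr_ge0.
Qed.

(** Entries as polynomials in time: continuity, measurability and differentiation then come from
    polynomials, and [Tpoly] is the antiderivative of [Lpoly] vanishing at 0. *)
Definition Lpoly n (A : 'M[R]_n) k i j : {poly R} :=
  \sum_(l < k) ((l`!%:R)^-1 * (A ^+ l) i j) *: 'X^l.

Definition Tpoly n (A : 'M[R]_n) k i j : {poly R} :=
  \sum_(l < k) ((A ^+ l) i j / (l.+1)`!%:R) *: 'X^(l.+1).

Lemma LpolyE n (A : 'M[R]_n) k i j s : Lmx A s k i j = (Lpoly A k i j).[s].
Proof.
rewrite /Lmx /Lpoly horner_sum summxE; apply: eq_bigr => l _.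
by rewrite exprmxZ !mxE hornerZ hornerXn; ring.
Qed.

Lemma TpolyE n (A : 'M[R]_n) k i j s : Tmx A s k i j = (Tpoly A k i j).[s].
Proof.
rewrite /Tmx /Tpoly horner_sum summxE; apply: eq_bigr => l _.
by rewrite !mxE hornerZ hornerXn; ring.
Qed.

Lemma deriv_Tpoly n (A : 'M[R]_n) k i j : (Tpoly A k i j)^`()%R = Lpoly A k i j.
Proof.
rewrite /Tpoly /Lpoly raddf_sum/=; apply: eq_bigr => l _.
rewrite derivZ derivXn/= -scalerMnr scalerMnl -mulr_natr; congr (_ *: _).
rewrite factS natrM invfM.
have : l.+1%:R != 0 :> R by rewrite pnatr_eq0.
have : l`!%:R != 0 :> R by rewrite pnatr_eq0 -lt0n fact_gt0.
by move: (l.+1%:R) (l`!%:R) => u v v0 u0; field; apply/andP.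
Qed.

Lemma integrable_bounded (f : R -> R) (s t C : R) :
  measurable_fun `[s, t] f -> (forall x, s <= x <= t -> `|f x| <= C) ->
  lebesgue_measure.-integrable `[s, t] (EFin \o f).
Proof.
move=> mf fC; apply: measurable_bounded_integrable => //.
  by rewrite /= lebesgue_measure_itv/=; case: ifP => _; rewrite ?ltry// -EFinB ltry.
exists C; split; first exact: num_real.
by move=> D CD x /= xst; rewrite ltW// (le_lt_trans (fC x _)).
Qed.

Lemma Rintegral_norm_le (f : R -> R) (t C : R) : 0 <= t ->
  measurable_fun `[0, t] f -> (forall x, 0 <= x <= t -> `|f x| <= C) ->
  `|\int[lebesgue_measure]_(x in `[0, t]) f x| <= C * t.
Proof.
move=> t0 mf fC; have C0 : 0 <= C.
  by rewrite (le_trans _ (fC 0 _)) ?lexx.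
have fi := integrable_bounded mf fC.
rewrite (le_trans (le_normr_Rintegral _ fi))//.
have -> : C * t = \int[lebesgue_measure]_(x in `[0, t]) C.
  rewrite Rintegral_cst//=; congr (_ * _).
  rewrite lebesgue_measure_itv/= lte_fin.
  by case: ltP => [|t0'] /=; [rewrite subr0|apply/eqP; rewrite eq_le t0' t0].
apply: le_Rintegral => //.
- apply: (@integrable_bounded _ _ _ C) => [|x /fC]; last by rewrite normr_id.
  exact: measurableT_comp.
- by apply: (@integrable_bounded _ _ _ C) => // x _; rewrite ger0_norm.
Qed.

(** A pointwise limit of polynomials in $s$. *)
Lemma measurable_expmx n (A : 'M[R]_n) i j (D : set R) : measurable D ->
  measurable_fun D (fun s => expmx (s *: A) i j).
Proof.
move=> mD; apply: (@measurable_fun_cvg _ _ _ _ (fun k s => (Lpoly A k i j).[s])).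
- move=> k; apply: measurable_funTS; apply: continuous_measurable_fun.
  exact: continuous_horner.
- move=> s _; rewrite (_ : (fun k => _) = fun k => pexp (s *: A) k i j).
    exact/cvg_mx_entry/pexp_cvg.
  by apply/funext => k; rewrite -LpolyE.
Qed.

Lemma measurable_Lmx n (A : 'M[R]_n) k i j (D : set R) :
  measurable_fun D (fun s => Lmx A s k i j).
Proof.
rewrite (_ : (fun s => _) = horner (Lpoly A k i j)); last first.
  by apply/funext => s; exact: LpolyE.
apply: measurable_funTS; apply: continuous_measurable_fun.
exact: continuous_horner.
Qed.

Lemma integrable_Lmx n (A : 'M[R]_n) t k i j :
  lebesgue_measure.-integrable `[0, t] (fun s => (Lmx A s k i j)%:E).
Proof.
pose r := t * (n%:R * `|A|).
apply: (@integrable_bounded _ _ _ (expR r + theta r k)) => [|s st].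
  exact: measurable_Lmx.
have /andP[s0 stt] := st.
have -> : Lmx A s k i j =
    expmx (s *: A) i j - (expmx (s *: A) - pexp (s *: A) k) i j.
  by rewrite !mxE subKr.
rewrite (le_trans (ler_normB _ _))// lerD//.
  exact: le_trans (entry_le_mx_norm _ _ _) (expmx_norm_le A st).
rewrite (le_trans (entry_le_mx_norm _ _ _))//.
rewrite (le_trans (expmx_tail_norm_le A k s0))// theta_homo//.
  by rewrite !mulr_ge0.
by rewrite ler_wpM2r// mulr_ge0.
Qed.

Lemma Rintegral_Lmx n (A : 'M[R]_n) t k i j : 0 < t ->
  \int[lebesgue_measure]_(s in `[0, t]) Lmx A s k i j = Tmx A t k i j.
Proof.
move=> t0; under eq_Rintegral do rewrite LpolyE.
rewrite /Rintegral (continuous_FTC2 (F := horner (Tpoly A k i j)) t0).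
- rewrite -EFinB/= -!TpolyE.
  suff -> : Tmx A 0 k i j = 0 by rewrite subr0.
  rewrite /Tmx summxE big1// => l _.
  by rewrite expr0n mul0r scale0r mxE.
- by apply: continuous_subspaceT => x; exact: continuous_horner.
- split; first by move=> x _; exact: derivable_horner.
    by apply: cvg_at_right_filter; exact: continuous_horner.
  by apply: cvg_at_left_filter; exact: continuous_horner.
- by move=> x _; rewrite -derivE deriv_Tpoly.
Qed.

(** The truncation error is at most $\theta(tn|A|,k)$ uniformly in $s\in[0,t]$, so the integrals
    differ by at most $t$ times that. *)
Lemma Tmx_cvg n (A : 'M[R]_n) t : 0 < t ->
  Tmx A t @ \oo --> mint t (fun s => expmx (s *: A)).
Proof.
move=> t0; have t0' := ltW t0; apply: cvg_mx => i j; rewrite mxE.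
have em : measurable_fun `[0, t] (fun s => expmx (s *: A) i j).
  exact: measurable_expmx.
have Ei : lebesgue_measure.-integrable `[0, t] (EFin \o (fun s => expmx (s *: A) i j)).
  apply: integrable_bounded => // s; move=> /(expmx_norm_le A); apply: le_trans.
  exact: entry_le_mx_norm.
have dif k s : 0 <= s <= t -> `|expmx (s *: A) i j - Lmx A s k i j| <=
    theta (t * (n%:R * `|A|)) k.
  move=> /andP[s0 st]; apply: le_trans (theta_homo _ _ (_ : s * (n%:R * `|A|) <= _)).
  - apply: le_trans (expmx_tail_norm_le A k s0).
    by have := entry_le_mx_norm (expmx (s *: A) - pexp (s *: A) k) i j; rewrite !mxE.
  - by rewrite !mulr_ge0.
  - by rewrite ler_wpM2r// mulr_ge0.
have h k : `|\int[lebesgue_measure]_(s in `[0, t]) expmx (s *: A) i j - Tmx A t k i j|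
    <= theta (t * (n%:R * `|A|)) k * t.
  rewrite -Rintegral_Lmx// -RintegralB//; last exact: integrable_Lmx.
  apply: Rintegral_norm_le => //; last exact: dif.
  by apply: measurable_funB => //; exact: measurable_Lmx.
apply/cvgrPdist_le => e e0.
have /cvgr0Pnorm_le/(_ _ e0) : theta (t * (n%:R * `|A|)) k * t @[k --> \oo] --> (0 : R).
  rewrite -(mul0r t).
  by apply: cvgM; [exact: theta_cvg0|exact: cvg_cst].
apply: filterS => k hk; rewrite (le_trans (h k))// (le_trans _ hk)//.
exact: ler_norm.
Qed.

Lemma cvg_det n (u : nat -> 'M[R]_n) (M : 'M[R]_n) :
  u @ \oo --> M -> (fun k => \det (u k)) @ \oo --> \det M.
Proof.
move=> uM; apply: cvg_big => [|s _]; first exact: add_continuous.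
apply: cvgM; first exact: cvg_cst.
apply: cvg_big => [|i _]; first exact: mul_continuous.
exact: cvg_mx_entry.
Qed.

(** The determinants converge to the nonzero determinant of the integral; this makes [eta_idx]
    attained. *)
Lemma near_Tmx_unitmx n (A : 'M[R]_n) t : 0 < t -> inI A t ->
  \forall k \near \oo, Tmx A t k \in unitmx.
Proof.
move=> t0 [_]; rewrite unitmxE unitfE => d0.
have := cvgr_neq0 _ (cvg_det (Tmx_cvg (A := A) t0)) d0 => /(_ _).
by apply: filterS => k; rewrite unitmxE unitfE.
Qed.

End TruncatedIntegral.

(** * Reachable sets *)

Section IntegralTranslation.
Context {R : realType}.

Lemma measurable_addr (a : R) (D : set R) : measurable_fun D (fun x : R => x + a).
Proof. by apply: measurable_funD => //; exact: measurable_cst. Qed.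

Let phi (a : R) : measurableTypeR R -> measurableTypeR R := fun x => x + a.

Let mphi a : measurable_fun setT (phi a).
Proof. exact: measurable_addr. Qed.

Lemma preimage_addr_itv (a x y : R) b c :
  (fun z => z + a) @^-1` [set` Interval (BSide b x) (BSide c y)] =
  [set` Interval (BSide b (x - a)) (BSide c (y - a))].
Proof.
by case: b c => [] []; apply/seteqP; split => z /=; rewrite !in_itv/=;
  move=> /andP[? ?]; apply/andP; split; lra.
Qed.

(** By uniqueness of Lebesgue measure it suffices to compare on half-open intervals, whose preimages
    are intervals of the same length. *)
Lemma lebesgue_measure_shift (a : R) (A : set R) : measurable A ->
  lebesgue_measure A = pushforward lebesgue_measure (phi a) A.
Proof.
pose phim := isMeasurableFun.Build _ _ _ _ (phi a) (@mphi a).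
pose phia : {mfun _ >-> _} := HB.pack (phi a) phim.
apply: (@lebesgue_measure_unique R
  (pushforward lebesgue_measure phia : {measure set _ -> \bar R})) => _ [[x y] _ <-].
transitivity (lebesgue_measure `]x - a, y - a]%classic); last first.
  by congr (lebesgue_measure _); rewrite -preimage_addr_itv.
rewrite !lebesgue_measure_itv/= !lte_fin ltrBlDr subrK.
by case: ifP => // _; rewrite -!EFinD opprB addrA subrK.
Qed.

(** Change of variables through the pushforward, after extending [f] by zero to the line; the bound
    [C] provides integrability. *)
Lemma Rintegral_shift (f : R -> R) (a b C : R) :
  measurable_fun `[a, a + b] f -> (forall x, a <= x <= a + b -> `|f x| <= C) ->
  \int[lebesgue_measure]_(x in `[a, a + b]) f x =
  \int[lebesgue_measure]_(x in `[0, b]) f (x + a).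
Proof.
move=> mf fC; rewrite /Rintegral; congr fine.
have preD : phi a @^-1` `[a, a + b] = `[0, b]%classic.
  by rewrite [LHS]preimage_addr_itv subrr addrAC subrr add0r.
pose g : R -> \bar R := (EFin \o f) \_ `[a, a + b].
have gphi : g \o phi a = (fun x => (f (x + a))%:E) \_ `[0, b].
  apply/funext => x; rewrite /g /patch/= /phi -preD.
  by congr (if _ then _ else _); rewrite !in_setE.
have mg : measurable_fun setT g.
  apply/(measurable_restrictT _ (measurable_itv _)).
  exact/measurable_EFinP.
rewrite [LHS]integral_mkcond [RHS]integral_mkcond -/g -gphi.
pose phim := isMeasurableFun.Build _ _ _ _ (phi a) (@mphi a).
pose phia : {mfun _ >-> _} := HB.pack (phi a) phim.
rewrite (eq_measure_integral
  (pushforward lebesgue_measure phia : {measure set _ -> \bar R})); last first.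
  by move=> A mA _; exact: lebesgue_measure_shift.
rewrite (integral_pushforward (mphi a) mg)//=.
rewrite preimage_setT gphi -/(_ \_ _).
suff : lebesgue_measure.-integrable `[0, b] (fun x => (f (x + a))%:E).
  by move=> /integrable_mkcond; exact.
apply: (@integrable_bounded _ _ _ _ C) => [|x xb]; last by apply: fC; lra.
apply: (measurable_comp (F := `[a, a + b]%classic)) mf _ => //.
  by rewrite -preD => _ [x ? <-].
exact: measurable_addr.
Qed.

Lemma Rintegral_sum (D : set R) I (r : seq I) (f : I -> R -> R) :
  measurable D ->
  (forall i, lebesgue_measure.-integrable D (EFin \o f i)) ->
  \int[lebesgue_measure]_(x in D) (\sum_(i <- r) f i x) =
  \sum_(i <- r) \int[lebesgue_measure]_(x in D) f i x.
Proof.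
move=> mD fi; elim: r => [|i r ih].
  under eq_Rintegral do rewrite big_nil.
  by rewrite big_nil Rintegral_cst// mul0r.
under eq_Rintegral do rewrite big_cons.
rewrite big_cons RintegralD// ?ih//.
have := @integrable_sum _ _ _ lebesgue_measure D mD I r xpredT (fun i => EFin \o f i).
move=> /(_ (fun i _ => fi i)); congr (integrable _ _ _).
by apply/funext => x /=; rewrite -sumEFin.
Qed.

Lemma vint_mulmx m n (M : 'M[R]_(m, n)) t (f : R -> 'cV[R]_n) :
  (forall i, lebesgue_measure.-integrable `[0, t] (fun s => (f s i ord0)%:E)) ->
  vint t (fun s => M *m f s) = M *m vint t f.
Proof.
move=> fi; apply/colP => i; rewrite !mxE.
under eq_Rintegral do rewrite mxE.
rewrite Rintegral_sum//.
  apply: eq_bigr => j _; rewrite RintegralZl//; [by rewrite mxE|exact: fi].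
by move=> j; exact: (integrableZl _ (M i j) (fi j)).
Qed.

End IntegralTranslation.

(** * The semigroup law for sets reached by inputs *)

Section Reachable.
Context {R : realType} (n : nat) (A : 'M[R]_n) (U : set 'cV[R]_n) (K : R).
Hypothesis UK : forall u, U u -> `|u| <= K.

Let flow (w : R -> 'cV[R]_n) s := expmx (s *: A) *m w s.

Lemma measurable_flow (D : set R) (w : R -> 'cV[R]_n) : measurable D ->
  (forall i, measurable_fun D (fun s => w s i ord0)) ->
  forall i, measurable_fun D (fun s => flow w s i ord0).
Proof.
move=> mD mw i.
rewrite (_ : (fun s => _) = fun s => \sum_j expmx (s *: A) i j * w s j ord0); last first.
  by apply/funext => s; rewrite mxE.
apply: measurable_sum => j; apply: measurable_funM => //.
exact: measurable_expmx.
Qed.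

(** Boundedness of [U] makes the integrand of every selection bounded, hence integrable. *)
Lemma flow_le t w s i : U (w s) -> 0 <= s <= t ->
  `|flow w s i ord0| <= n%:R * expR (t * (n%:R * `|A|)) * K.
Proof.
move=> Uw st; rewrite (le_trans (entry_le_mx_norm _ _ _))//.
rewrite (le_trans (mulmx_norm_le _ _))// ler_pM ?mulr_ge0//; last exact: UK.
by rewrite ler_wpM2l// expmx_norm_le.
Qed.

Lemma integrable_flow t w i : msel t U w ->
  lebesgue_measure.-integrable `[0, t] (fun s => (flow w s i ord0)%:E).
Proof.
move=> [wU mw].
apply: (@integrable_bounded _ _ _ _ (n%:R * expR (t * (n%:R * `|A|)) * K)).
  exact: measurable_flow.
by move=> s st; apply: flow_le => //; apply: wU; rewrite /= in_itv.
Qed.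

Lemma msel_shift a b w : 0 <= a -> msel (a + b) U w ->
  msel b U (fun s => w (s + a)).
Proof.
move=> a0 [wU mw]; split=> [s|i].
  by rewrite /= in_itv/= => sb; apply: wU; rewrite /= in_itv/=; lra.
apply: (measurable_comp (F := `[0, a + b]%classic)) (mw i) _ => //.
  by move=> _ [s /= + <-]; rewrite !in_itv/=; lra.
exact: measurable_addr.
Qed.

Lemma msel_le a b w : a <= b -> msel b U w -> msel a U w.
Proof.
move=> ab [wU mw]; split=> [s|i].
  by rewrite /= in_itv/= => sb; apply: wU; rewrite /= in_itv/=; lra.
apply: measurable_funS (mw i) => //.
by move=> s /=; rewrite !in_itv/=; lra.
Qed.

(** The integral is cut at $a$; on the second piece time is translated and $e^{(s+a)A}=e^{aA}e^{sA}$
    is pulled out. *)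
Lemma vint_flow_split a b w : 0 <= a -> 0 <= b -> msel (a + b) U w ->
  vint (a + b) (flow w) =
  vint a (flow w) + expmx (a *: A) *m vint b (flow (fun s => w (s + a))).
Proof.
move=> a0 b0 wS.
rewrite -vint_mulmx => [|i]; last exact/integrable_flow/msel_shift.
apply/colP => i; rewrite !mxE; have [wU mw] := wS.
have fi := integrable_flow i wS.
rewrite -[LHS](subrK (\int[lebesgue_measure]_(x in `[0, a]) flow w x i ord0)).
rewrite addrC; congr (_ + _).
rewrite Rintegral_itvB//; rewrite ?bnd_simp ?lerDl//.
rewrite Rintegral_itv_obnd_cbnd; last first.
  apply: integrableS fi => //.
  by move=> s /=; rewrite !in_itv/=; lra.
rewrite (@Rintegral_shift _ _ a b (n%:R * expR ((a + b) * (n%:R * `|A|)) * K)).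
- apply: eq_Rintegral => s _; rewrite /flow.
  by rewrite addrC expmxDZ mulmxA.
- apply: measurable_flow => // j; apply: measurable_funS (mw j) => //.
  by move=> s /=; rewrite !in_itv/=; lra.
- move=> s sab; have s0 : 0 <= s <= a + b by lra.
  by apply: flow_le => //; apply: wU; rewrite /= in_itv.
Qed.

Lemma reach_u0 : U !=set0 -> reach_u A U 0 = [set 0].
Proof.
have v0 (f : R -> 'cV[R]_n) : vint 0 f = 0.
  by apply/colP => i; rewrite !mxE set_itv1 Rintegral_set1.
move=> [u Uu]; apply/seteqP; split => [_ [w _ <-]|_ ->].
  exact: v0.
by exists (fun=> u); [split => // i; exact: measurable_cst|exact: v0].
Qed.

Lemma reach_uD a b : 0 <= a -> 0 <= b ->
  reach_u A U (a + b) =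
  minksum (reach_u A U a) (mimg (expmx (a *: A)) (reach_u A U b)).
Proof.
move=> a0 b0; apply/seteqP; split.
  move=> _ [w wS <-]; exists (vint a (flow w)).
    by exists w => //; apply: msel_le wS; rewrite lerDl.
  exists (expmx (a *: A) *m vint b (flow (fun s => w (s + a)))).
    exists (vint b (flow (fun s => w (s + a)))) => //.
    by exists (fun s => w (s + a)) => //; exact: msel_shift.
  by rewrite -vint_flow_split.
move=> _ [_ [w1 [w1U mw1] <-] [_ [_ [w2 [w2U mw2] <-] <-] <-]].
(* Concatenation; at the junction $s=a$ the value is that of [w1]. *)
pose w s := if s <= a then w1 s else w2 (s - a).
have wS : msel (a + b) U w.
  split=> [s|i].
    rewrite /= in_itv/= /w => sab; case: ifPn => sa.
      by apply: w1U; rewrite /= in_itv/=; lra.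
    by apply: w2U; rewrite /= in_itv/=; lra.
  rewrite (_ : (fun s => _) = fun s => if s <= a then w1 s i ord0
      else w2 (s - a) i ord0); last by apply/funext => s; rewrite /w; case: ifP.
  apply: measurable_fun_if => //.
  - exact: measurable_fun_ler.
  - apply: measurable_funS (mw1 i) => // s [] /=; rewrite !in_itv/=; lra.
  - apply: (measurable_comp (F := `[0, b]%classic)) (mw2 i) _ => //.
      move=> _ [s /= [+ /negbT +] <-]; rewrite !in_itv/=; lra.
    exact: measurable_addr.
have e1 : vint a (flow w) = vint a (flow w1).
  apply/colP => i; rewrite !mxE; apply: eq_Rintegral => s.
  by rewrite inE/= in_itv/= /flow /w => /andP[_ ->].
have e2 : vint b (flow (fun s => w (s + a))) = vint b (flow w2).
  apply/colP => i; rewrite !mxE.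
  (* At time 0 the shifted selection still takes the value [w1 a], so the comparison is made on the
     interval without its left endpoint. *)
  rewrite -[LHS]Rintegral_itv_obnd_cbnd; last first.
    apply: integrableS (integrable_flow i (msel_shift a0 wS)) => //.
    by move=> s /=; rewrite !in_itv/=; lra.
  rewrite -[RHS]Rintegral_itv_obnd_cbnd; last first.
    apply: integrableS (@integrable_flow b w2 i _) => //.
    by move=> s /=; rewrite !in_itv/=; lra.
  apply: eq_Rintegral => s; rewrite inE/= in_itv/= /flow /w => sb.
  by rewrite ifF ?addrK//; lra.
by exists w => //; rewrite -e1 -e2; exact: vint_flow_split.
Qed.

End Reachable.

(** * Inclusions along the recursion *)

Section Reachability.
Context {R : realType} (nrm : forall k, 'cV[R]_k -> R) (n : nat) (A : 'M[R]_n).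
Hypothesis nrmP : forall k, is_norm (@nrm k).

Lemma zset_bounded (Om : zono R n) :
  exists K : R, forall u, zset (@nrm) Om u -> `|u| <= K.
Proof.
have [D D0 hD] := mx_norm_le_is_norm (nrmP (zp Om)).
exists (`|zc Om| + (zp Om)%:R * `|zG Om| * D) => _ [b b1 <-].
rewrite (le_trans (ler_normD _ _))// lerD2l (le_trans (mulmx_norm_le _ _))//.
rewrite ler_wpM2l ?mulr_ge0// (le_trans (hD b))//.
by rewrite -[leRHS]mulr1 ler_wpM2l.
Qed.

Lemma zset_nonempty (Om : zono R n) : zset (@nrm) Om !=set0.
Proof.
by exists (zc Om + zG Om *m 0), 0 => //; rewrite /uball/= is_norm0.
Qed.

Lemma Iz_spec t (Om : zono R n) e :
  0 < t -> inI A t -> 0 <= e < 1 -> inA Om ->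
  inA (Iz (@nrm) A t Om e) /\
  zset (@nrm) (Iz (@nrm) A t Om e) `<=` reach_u A (zset (@nrm) Om) t.
Proof.
move=> t0 tI /andP[e0 e1] OmA; rewrite /Iz.
have : e < lam (@nrm) A t Om (eta_idx (@nrm) A t Om e) /\
    Tmx A t (eta_idx (@nrm) A t Om e) \in unitmx.
  apply: (nat_minP (P := fun k => e < lam _ _ _ _ k /\ Tmx A t k \in unitmx)).
  (* Both conditions on the index hold eventually, hence simultaneously at some index. *)
  have [k _ kP] := filterI (near_lt_lam (@nrm) A t Om e1) (near_Tmx_unitmx t0 tI).
  by exists k; exact: (kP k (leqnn k)).
set k := eta_idx _ _ _ _ _; set l := lam _ _ _ _ _ => -[el Tu].
have l0 : 0 < l by exact: le_lt_trans el.
have lN0 : l != 0 by rewrite gt_eqF.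
split; first exact: inA_scale_mul.
move=> _ [b b1 <-] /=; set x := zc Om + l *: (zG Om *m b).
have -> : Tmx A t k *m zc Om + l *: (Tmx A t k *m zG Om) *m b = Tmx A t k *m x.
  by rewrite /x mulmxDr -scalemxAr -scalemxAl mulmxA.
(* The flow turns this selection into $L(s,k)x$, whose integral is $T(t,k)x$. *)
exists (fun s => expmx (- s *: A) *m (Lmx A s k *m x)).
  split=> [s|i].
    rewrite /= in_itv/= => st; apply: flow_back_truncation => //.
    exact: ltW.
  rewrite (_ : (fun s => _) =
      fun s => (expmx (s *: - A) *m (Lmx A s k *m x)) i ord0); last first.
    by apply/funext => s; rewrite scaleNr -scalerN.
  apply: measurable_flow => // j.
  rewrite (_ : (fun s => _) = fun s => \sum_l0 Lmx A s k j l0 * x l0 ord0); last first.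
    by apply/funext => s; rewrite mxE.
  apply: measurable_sum => m; apply: measurable_funM; first exact: measurable_Lmx.
  exact: measurable_cst.
apply/colP => i; rewrite !mxE.
transitivity (\int[lebesgue_measure]_(s in `[0, t]) \sum_m Lmx A s k i m * x m ord0).
  by apply: eq_Rintegral => s _; rewrite mulmxA expmxVZ mul1mx mxE.
have Li m := integrable_Lmx A t k i m.
rewrite Rintegral_sum//.
  by apply: eq_bigr => m _; rewrite RintegralZr ?Rintegral_Lmx//; exact: Li.
move=> m; exact: (integrableZr _ (x m ord0) (Li m)).
Qed.

Lemma iter_mimg_expmx t i (X : set 'cV[R]_n) :
  iter i (mimg (expmx (t *: A))) X = mimg (expmx ((i%:R * t) *: A)) X.
Proof.
have mimgM (M N : 'M[R]_n) Y : mimg M (mimg N Y) = mimg (M *m N) Y.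
  apply/seteqP; split=> [_ [_ [y Yy <-] <-]|_ [y Yy <-]].
    by exists y => //; rewrite mulmxA.
  by exists (N *m y); [exists y|rewrite mulmxA].
elim: i => [|i ih] /=.
  rewrite mul0r scale0r expmx0; apply/seteqP; split=> [x Xx|_ [x Xx <-]].
    by exists x; rewrite ?mul1mx.
  by rewrite mul1mx.
by rewrite ih mimgM -expmxDZ -natr1 mulrDl mul1r addrC.
Qed.

Lemma subset_mimg m (M : 'M[R]_(m, n)) X Y : X `<=` Y -> mimg M X `<=` mimg M Y.
Proof. by move=> XY _ [x Xx <-]; exists x => //; exact: XY. Qed.

Lemma subset_minksum (X X' Y Y' : set 'cV[R]_n) :
  X `<=` X' -> Y `<=` Y' -> minksum X Y `<=` minksum X' Y'.
Proof.
by move=> XX' YY' _ [x Xx [y Yy <-]]; exists x; [exact: XX'|exists y; [exact: YY'|]].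
Qed.

Lemma subset_accum (V W : nat -> set 'cV[R]_n) i :
  (forall j, V j `<=` W j) -> accum V i `<=` accum W i.
Proof. by move=> VW; elim: i => [//|i ih] /=; exact: subset_minksum. Qed.

(** Full row rank is carried along with the inclusion, since each step requires it. The set [X] is
    arbitrary so that both recursions, from $X_0$ and from $\mathcal{R}_u(\tau)$, are covered. *)
Lemma iter_Hz_spec t e (Om : zono R n) (X : set 'cV[R]_n) i :
  0 <= t -> 0 <= e < 1 -> inA Om -> zset (@nrm) Om `<=` X ->
  inA (iter i (fun Om => Hz (@nrm) A t Om e) Om) /\
  zset (@nrm) (iter i (fun Om => Hz (@nrm) A t Om e) Om) `<=`
    iter i (mimg (expmx (t *: A))) X.
Proof.
move=> t0 e01 OmA OmX; elim: i => [//|i [iA iX]] /=.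
have [HA HX] := Hz_spec A nrmP t0 e01 iA; split => //.
by move=> x /HX; exact: subset_mimg.
Qed.

(** Each summand extends the horizon by one step: [reach_uD] with $a=it$ and $b=t$. *)
Lemma accum_reach_u t (U : set 'cV[R]_n) (K : R) i :
  0 <= t -> U !=set0 -> (forall u, U u -> `|u| <= K) ->
  accum (fun j => iter j (mimg (expmx (t *: A))) (reach_u A U t)) i =
  reach_u A U (i%:R * t).
Proof.
move=> t0 U0 UK; elim: i => [|i ih] /=; first by rewrite mul0r reach_u0.
rewrite ih iter_mimg_expmx -natr1 mulrDl mul1r (reach_uD A UK)//.
by rewrite mulr_ge0.
Qed.

End Reachability.

Unset Implicit Arguments.

Theorem theorem1 (R : realType) (nrm : forall k, 'cV[R]_k -> R)
    (n : nat) (A : 'M[R]_n) (T : R) (X0 U : zono R n) (N : nat) (eh eu : R) :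
  (forall k, is_norm (nrm k)) ->
  0 < T -> inA X0 -> inA U -> (0 < N)%N ->
  0 <= eh < 1 -> 0 <= eu < 1 ->
  let tau := T / N%:R in
  inI A tau ->
  let E := expmx (tau *: A) in
  (* the computed sets *)
  let Sz := fun i => iter i (fun Om => Hz nrm A tau Om eh) X0 in
  let Vz := fun i => iter i (fun Om => Hz nrm A tau Om eh) (Iz nrm A tau U eu) in
  let Wc := accum (fun i => zset nrm (Vz i)) in
  let Lam := fun i => minksum (zset nrm (Sz i)) (Wc i) in
  (* the exact sets *)
  let S := fun i => iter i (mimg E) (zset nrm X0) in
  let V := fun i => iter i (mimg E) (reach_u A (zset nrm U) tau) in
  let W := accum V in
  let Gam := fun i => minksum (S i) (W i) in
  (forall i, (i <= N)%N ->
     zset nrm (Sz i) `<=` S i /\ S i = reach_h A (zset nrm X0) (i%:R * tau) /\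
     zset nrm (Vz i) `<=` V i /\
     Wc i `<=` W i /\ W i = reach_u A (zset nrm U) (i%:R * tau) /\
     Lam i `<=` Gam i /\ Gam i = reach A (zset nrm X0) (zset nrm U) (i%:R * tau)) /\
  \bigcup_(i in [set i | (i <= N)%N]) Lam i `<=` reach_int A (zset nrm X0) (zset nrm U) T.
Proof.
move=> nrmP T0 X0A UA N0 eh01 eu01 tau tauI E Sz Vz Wc Lam S V W Gam.
have Nr0 : 0 < N%:R :> R by rewrite ltr0n.
have tau0 : 0 < tau by exact: divr_gt0.
have [IA IV] := Iz_spec nrmP tau0 tauI eu01 UA.
have SzS i : zset nrm (Sz i) `<=` S i.
  by have [] := iter_Hz_spec A nrmP i (ltW tau0) eh01 X0A (@subset_refl _ _).
have VzV i : zset nrm (Vz i) `<=` V i.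
  by have [] := iter_Hz_spec A nrmP i (ltW tau0) eh01 IA IV.
have WcW i : Wc i `<=` W i by exact: subset_accum.
have SE i : S i = reach_h A (zset nrm X0) (i%:R * tau) by exact: iter_mimg_expmx.
have [K UK] := zset_bounded nrmP U.
have WE i : W i = reach_u A (zset nrm U) (i%:R * tau).
  exact: (accum_reach_u A i (ltW tau0) (zset_nonempty nrmP U) UK).
have LG i : Lam i `<=` Gam i by exact: subset_minksum.
have GE i : Gam i = reach A (zset nrm X0) (zset nrm U) (i%:R * tau).
  by rewrite /Gam SE WE.
split=> [i _|x [i iN Lx]].
  by do !split => //.
(* The time $i\tau$ lies in $[0,T]$ because $i\le N$. *)
exists (i%:R * tau); last by rewrite -GE; exact: LG.
rewrite /= in_itv/= mulr_ge0 ?(ltW tau0)//= /tau mulrCA ger_pMr//.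
by rewrite ler_pdivrMr// mul1r ler_nat.
Qed.
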